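(* Let $L$ be a finite dimensional complex Leibniz algebra, and let $\Im_1$ and $\Im_2$ be Cartan subalgebras of $L$. Then there exists an invariant automorphism $\delta$ of $L$ such that $\delta(\Im_1)=\Im_2$.
   Context: A Leibniz algebra over a field $F$ is an $F$-vector space $L$ with a bilinear multiplication $[\cdot,\cdot]$ satisfying $[x,[y,z]]=[[x,y],z]-[[x,z],y]$ for all $x,y,z\in L$. For $x\in L$, $R_x:L\to L$ denotes the right multiplication operator $R_x(z)=[z,x]$. For an algebra $A$ put $A^1=A$, $A^{n+1}=[A^n,A^1]$; $A$ is nilpotent if $A^s=0$ for some $s\in\mathbb{N}$. A subalgebra $\Im$ of a Leibniz algebra $L$ is called a Cartan subalgebra if (a) $\Im$ is nilpotent, and (b) $\Im$ coincides with its left normalizator $l(\Im)=\{x\in L : [x,\Im]\subseteq\Im\}$. If $x\in L$ is such that $R_x$ is a nilpotent endomorphism of $L$ (over a field of characteristic zero), then $\exp(R_x)$ is an automorphism of the algebra $L$. An invariant automorphism of $L$ is any (finite) product of automorphisms of the form $\exp(R_x)$ with $R_x$ nilpotent. *)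

(* Defs.v *)
From mathcomp Require Import all_boot all_order all_algebra.
From mathcomp.real_closed Require Export complex.

Set Implicit Arguments.
Unset Strict Implicit.
Unset Printing Implicit Defensive.

Import GRing.Theory.
Local Open Scope ring_scope.

Section Leibniz.
Variables (F : fieldType) (L : vectType F) (mu : {bilinear L -> L -> L}).

Implicit Types (x y z : L) (U V W H : {vspace L}) (f g : 'End(L)).

Definition leibniz_identity : Prop :=
  forall x y z, mu x (mu y z) = mu (mu x y) z - mu (mu x z) y.

Definition rmul x : 'End(L) := linfun (applyr mu x).

Lemma rmulE x z : rmul x z = mu z x.
Proof. exact: lfunE. Qed.

Definition bracketv U V : {vspace L} :=
  <<[seq mu u v | u <- vbasis U, v <- vbasis V]>>%VS.

Lemma memv_bracket U V x y : x \in U -> y \in V -> mu x y \in bracketv U V.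
Proof.
move=> /coord_vbasis-> /coord_vbasis->.
rewrite linear_sumlz; apply: memv_suml => i _.
rewrite linear_sumr; apply: memv_suml => j _.
rewrite linearZl_LR linearZr_LR; do 2 apply: rpredZ.
by apply/memv_span/allpairs_f; apply: mem_nth; rewrite size_tuple.
Qed.

Lemma bracketv_subP U V W :
  (forall x y, x \in U -> y \in V -> mu x y \in W) <-> (bracketv U V <= W)%VS.
Proof.
split=> [UVW | /subvP sUVW x y Ux Vy]; last exact/sUVW/memv_bracket.
apply/span_subvP => _ /allpairsP[[x y] /= [Ux Vy ->]].
by apply: UVW; apply: vbasis_mem.
Qed.

Definition subalgebra H : Prop :=
  forall x y, x \in H -> y \in H -> mu x y \in H.

(* [lower_power H n] is H^(n+1). *)
Definition lower_power H n : {vspace L} := iter n (bracketv^~ H) H.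

Definition nilpotent_subalgebra H : Prop :=
  exists n, lower_power H n = 0%VS.

Definition left_normalizer H x : Prop := forall h, h \in H -> mu x h \in H.

Definition cartan_subalgebra H : Prop :=
  [/\ subalgebra H, nilpotent_subalgebra H &
      forall x, x \in H <-> left_normalizer H x].

Definition automorphism f : Prop :=
  lker f = 0%VS /\ forall x y, f (mu x y) = mu (f x) (f y).

(* 'End(L) is not canonically a ring since L may be trivial, hence the explicit
   iterated composition. *)
Definition lfun_exp f n : 'End(L) := iter n (comp_lfun f) \1%VF.

(* g = exp(f) for a nilpotent f: the exponential series can be truncated at any
   n such that f^n = 0. In particular [exp_nilp f g] entails that f is
   nilpotent. *)
Definition exp_nilp f g : Prop :=
  exists2 n, lfun_exp f n = 0 &
    g = \sum_(k < n) (k`!%:R)^-1 *: lfun_exp f k.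

Inductive invariant_automorphism : 'End(L) -> Prop :=
| invariant_id : invariant_automorphism \1%VF
| invariant_comp x g f :
    exp_nilp (rmul x) g -> automorphism g -> invariant_automorphism f ->
    invariant_automorphism (g \o f)%VF.

End Leibniz.

(* Main.v *)
(* Each x in L gives a generalized null component N(x) of R_x, which is unchanged
   when x is translated by the right center Z = {z | R_z = 0}.  A Cartan subalgebra
   H is N(a) for some a in H: a minimizes dim N on H, and Engel's argument excludes
   N(a) <> H.  For e in a generalized eigenspace of R_a with nonzero eigenvalue,
   R_e is nilpotent.  The map sending (h, c, z) to
   exp(R_(c1 e1)) ... exp(R_(cm em)) (a + h) + z, with h in N(a) and z in Z,
   has a surjective derivative at 0: left multiplication by a is not
   invertible on the nonzero eigenspaces (as it would be in a Lie algebra), but it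
   agrees with - R_a up to Z.  By the inverse function theorem, every y close to a
   has N(y) conjugate to N(h) for some h in N(a).  Hence a is regular (dim N(a) is
   minimal over L) and the conjugacy class of N is locally constant on the regular
   elements.  Any two regular elements a, b are joined by a path
   a + (s + i c s (1 - s)) (b - a) of regular elements, because only finitely many
   points of the complex line through a and b are not regular. *)

Require Import Defs.
From HB Require Import structures.
From mathcomp Require Import all_boot all_order all_algebra.
From mathcomp Require Import boolp classical_sets reals.
From mathcomp.real_closed Require Import complex.
From mathcomp Require Import ring lra.

Set Implicit Arguments.
Unset Strict Implicit.
Unset Printing Implicit Defensive.

Import Order.TTheory GRing.Theory Num.Theory VectorInternalTheory.
Local Open Scope ring_scope.

(** * Fitting null component and generalized eigenspaces *)

Section Fitting.
Variables (F : fieldType) (V : vectType F).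
Implicit Types (f g : 'End(V)) (u v w : V) (l m : F) (s : seq F).

Lemma lfun_expE f n v : lfun_exp f n v = iter n f v.
Proof. by elim: n => [|n IHn]; rewrite /= ?id_lfunE ?comp_lfunE ?IHn. Qed.

Lemma iter_lfun0 f n : iter n f 0 = 0.
Proof. by rewrite -lfun_expE linear0. Qed.

Lemma iter_lfunD f n u v : iter n f (u + v) = iter n f u + iter n f v.
Proof. by rewrite -!lfun_expE linearD. Qed.

Lemma iter_lfun_eq0 f k n v : (k <= n)%N -> iter k f v = 0 -> iter n f v = 0.
Proof. by move=> /subnK<- fv; rewrite iterD fv iter_lfun0. Qed.

Lemma iter_scale_lfun f n l v : iter n (l *: f) v = l ^+ n *: iter n f v.
Proof.
elim: n => [|n IHn]; first by rewrite scale1r.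
by rewrite !iterS IHn scale_lfunE linearZ scalerA exprS.
Qed.

Definition null_component f : {vspace V} := lker (lfun_exp f (dim V)).

Lemma null_componentE f v : (v \in null_component f) = (iter (dim V) f v == 0).
Proof. by rewrite memv_ker lfun_expE. Qed.

(** Otherwise the dimension of the kernels would grow at each of [dim V + 1] successive steps. *)
Lemma ker_chain_stops f :
  exists2 i, (i <= dim V)%N &
    (lker (lfun_exp f i.+1) <= lker (lfun_exp f i))%VS.
Proof.
have [/existsP[i Hi] | noi'] := boolP [exists i : 'I_(dim V).+1,
   (lker (lfun_exp f i.+1) <= lker (lfun_exp f i))%VS].
  by exists i; rewrite // -ltnS.
have noi i (lei : (i < (dim V).+1)%N) : ~~ (lker (lfun_exp f i.+1) <= lker (lfun_exp f i))%VS.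
  by apply: contra noi' => Hi; apply/existsP; exists (Ordinal lei).
suff /(_ (dim V).+1 (leqnn _)): forall i, (i <= (dim V).+1)%N ->
    (i <= \dim (lker (lfun_exp f i)))%N.
  by move/leq_trans/(_ (dimvS (subvf _))); rewrite dimvf ltnn.
elim=> // i IHi lei; apply: leq_ltn_trans (IHi (ltnW lei)) _.
have sub : (lker (lfun_exp f i) <= lker (lfun_exp f i.+1))%VS.
  by apply/subvP=> v; rewrite !memv_ker !lfun_expE iterS => /eqP->; rewrite linear0.
by rewrite (ltn_leqif (dimv_leqif_sup sub)) noi.
Qed.

(** Once the kernels of two successive powers agree they stay constant, and this happens at an
    exponent at most [dim V]. *)
Lemma null_componentP f v :
  reflect (exists k, iter k f v = 0) (v \in null_component f).
Proof.
rewrite null_componentE; apply: (iffP eqP) => [|[k fkv]]; first by exists (dim V).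
have [i lei /subvP stop] := ker_chain_stops f.
apply: iter_lfun_eq0 lei _.
have [leki | /ltnW leik] := leqP k i; first exact: iter_lfun_eq0 fkv.
elim: k leik fkv => [|k IHk]; first by rewrite leqn0 => /eqP->.
rewrite leq_eqVlt => /predU1P[-> // | ]; rewrite ltnS => leik fkv; apply: (IHk leik).
have/stop: iter (k - i) f v \in lker (lfun_exp f i.+1).
  by rewrite memv_ker lfun_expE -iterD addSn subnKC ?fkv.
by rewrite memv_ker lfun_expE -iterD subnKC // => /eqP.
Qed.

Lemma null_component_stable f v :
  v \in null_component f -> f v \in null_component f.
Proof.
by move/null_componentP=> [k fkv]; apply/null_componentP; exists k; rewrite -iterSr iterS fkv linear0.
Qed.

Lemma null_component_iter f n v :
  (iter n f v \in null_component f) = (v \in null_component f).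
Proof.
apply/idP/idP => [/null_componentP[k] | ].
  by rewrite -iterD => fv; apply/null_componentP; exists (k + n)%N.
by elim: n => // n IHn fv; rewrite iterS null_component_stable ?IHn.
Qed.

Definition geneigenspace f l := null_component (f - l *: \1%VF).

Lemma sub_scalarE f l v : (f - l *: \1%VF) v = f v - l *: v.
Proof. by rewrite add_lfunE opp_lfunE scale_lfunE id_lfunE. Qed.

Lemma geneigenspace0 f : geneigenspace f 0 = null_component f.
Proof. by rewrite /geneigenspace scale0r subr0. Qed.

(** On the generalized eigenspace for [l], [f - m] is a nonzero scalar plus a nilpotent map, hence
    invertible. The induction is on the nilpotency order of [u]. *)
Lemma geneigenspace_solve f l m u : l != m -> u \in geneigenspace f l ->
  exists2 w, w \in geneigenspace f l & f w - m *: w = u.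
Proof.
move=> neq_lm /null_componentP[k].
elim: k u => [|k IHk] u; first by move=> /= ->; exists 0; rewrite ?mem0v // linear0 scaler0 subrr.
move=> fku; have [w' lw' w'E] := IHk ((f - l *: \1%VF) u) (etrans (esym (iterSr _ _ _)) fku).
(* Since [w'] solves the equation for [(f - l) u], applying [f - m] to [u - w'] gives
   [(l - m) u]. *)
exists ((l - m)^-1 *: (u - w')).
  by rewrite memvZ // memvB //; apply/null_componentP; exists k.+1.
have {}w'E : f w' = m *: w' + (f u - l *: u).
  by rewrite -[f w'](subrK (m *: w')) w'E sub_scalarE addrC.
rewrite linearZ linearB /= scalerA mulrC -scalerA -scalerBr {}w'E.
suff -> : f u - (m *: w' + (f u - l *: u)) - m *: (u - w') = (l - m) *: u.
  by rewrite scalerA mulVf ?scale1r // subr_eq0.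
rewrite scalerBl scalerBr; set x := f u; set y := m *: w'; set z := l *: u; set t := m *: u.
by rewrite opprD opprB [x + (_ + _)]addrCA [x + (_ - _)]addrC subrK opprB addrACA addNr add0r.
Qed.


Lemma geneigenspace_neq f l m v :
  v \in geneigenspace f l -> f v = m *: v -> l != m -> v = 0.
Proof.
move=> /null_componentP[k fkv] fv neq_lm; apply/eqP.
have : iter k (f - l *: \1%VF) v = (m - l) ^+ k *: v.
  elim: (k) => [|i IHi]; first by rewrite scale1r.
  by rewrite iterS IHi linearZ /= sub_scalarE fv -scalerBl scalerA exprSr.
rewrite fkv => /esym/eqP; rewrite scaler_eq0 => /orP[|//].
by rewrite expf_eq0 subr_eq0 eq_sym (negPf neq_lm) andbF.
Qed.

(** The fold applies the product of the [f - m] for [m] in [s]. Each factor preserves the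
    generalized eigenspace for [l] and is injective on it. *)
Lemma geneigenspace_notin f l s v :
  (forall u, foldl (fun w m => f w - m *: w) u s = 0) ->
  v \in geneigenspace f l -> l \notin s -> v = 0.
Proof.
move=> /(_ v); elim: s v => //= m s IHs v fv lv; rewrite inE negb_or => /andP[neq_lm ls].
apply: (geneigenspace_neq lv (m := m)) neq_lm.
apply/eqP; rewrite -subr_eq0; apply/eqP/(IHs _ fv) => //.
rewrite memvB ?memvZ //.
rewrite -[f v](subrK (l *: v)) memvD ?memvZ // -sub_scalarE.
exact: null_component_stable.
Qed.

(* If [(f - l) v = sum of u_m] with [u_m] in the generalized eigenspaces, then
   [f - l] can be inverted on those with [m <> l]. *)
Lemma geneigenspace_sum f s :
  (forall u, foldl (fun w m => f w - m *: w) u s = 0) ->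
  (\sum_(l <- s) geneigenspace f l)%VS = fullv.
Proof.
move=> fs; apply/vspaceP => v; rewrite memvf.
suff sub r : {subset r <= s} -> foldl (fun w m => f w - m *: w) v r = 0 ->
   v \in (\sum_(l <- s) geneigenspace f l)%VS by apply: (sub s).
have sups l u : l \in s -> u \in geneigenspace f l ->
    u \in (\sum_(l <- s) geneigenspace f l)%VS.
  move=> ls; apply/subvP; rewrite (big_rem l) //=; exact: addvSl.
elim: r v => [|m r IHr] v rs /=; first by move=> ->; rewrite mem0v.
move=> annr; have {IHr annr} := IHr _ (fun x xr => rs x (@mem_behead _ (m :: r) x xr)) annr.
have ms : m \in s by apply: rs; rewrite mem_head.
suff /(_ s (fun _ => id)) /[apply] [[w ws wv]] : forall t, {subset t <= s} ->
    forall u, u \in (\sum_(l <- t) geneigenspace f l)%VS ->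
    exists2 w, w \in (\sum_(l <- s) geneigenspace f l)%VS &
       u - (f w - m *: w) \in geneigenspace f m.
  rewrite -(subrK w v) memvD // (sups m) //.
  rewrite -(null_component_iter _ 1) /= sub_scalarE linearB scalerBr /=.
  by rewrite opprD addrACA -opprD.
elim=> [|l t IHt] ts u.
  by rewrite big_nil memv0 => /eqP->; exists 0; rewrite ?mem0v // linear0 scaler0 !subr0 mem0v.
rewrite big_cons => /memv_addP[u1 u1l [u2 u2t ->]].
have [|w2 w2s w2E] := IHt _ u2 u2t; first by move=> x xt; apply: ts; rewrite inE xt orbT.
have [eq_lm | neq_lm] := eqVneq l m.
  by exists w2; rewrite // -addrA memvD // -eq_lm.
have [w1 w1l w1E] := geneigenspace_solve neq_lm u1l.
exists (w1 + w2); first by rewrite memvD // (sups l) // ts // mem_head.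
have -> : f (w1 + w2) - m *: (w1 + w2) = u1 + (f w2 - m *: w2).
  by rewrite linearD scalerDr /= opprD addrACA w1E.
by rewrite opprD addrACA subrr add0r.
Qed.

End Fitting.

(** Cayley-Hamilton: [s] lists the roots of the characteristic polynomial. *)
Lemma annihilating_roots (F : closedFieldType) (V : vectType F) (f : 'End(V)) :
  exists s : seq F, forall u, foldl (fun w m => f w - m *: w) u s = 0.
Proof.
have mxP n (A : 'M[F]_n) : exists s : seq F,
    forall u : 'rV_n, foldl (fun w m => w *m A - m *: w) u s = 0.
  case: n A => [|n] A; first by exists [::] => u; rewrite [foldl _ _ _]thinmx0.
  have [s sE] := closed_field_poly_normal (char_poly A).
  exists s => u.
  have -> : foldl (fun w m => w *m A - m *: w) u s =
      u *m horner_mx A (\prod_(z <- s) ('X - z%:P)).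
    elim: (s) u => [|m t IHt] u /=; first by rewrite big_nil rmorph1 mulmx1.
    rewrite IHt big_cons rmorphM /= rmorphB /= horner_mx_X horner_mx_C.
    by rewrite -mulmxE mulmxA mulmxBr mul_mx_scalar.
  move: sE; rewrite (monicP (char_poly_monic A)) scale1r => <-.
  by rewrite Cayley_Hamilton mulmx0.
have [s sE] := mxP _ (f2mx f); exists s => u.
apply: v2r_inj; rewrite linear0 -[RHS](sE (v2r u)).
elim: (s) u => //= m t IHt u; rewrite IHt linearB linearZ /=.
congr (foldl _ (_ - _) _).
by rewrite unlock /= r2vK.
Qed.

(** * Exponentials of nilpotent endomorphisms *)

(** Cauchy product of truncated series: the support of [c] is in a square of side [n], so the
    diagonals [i + j = m] with [m < n + n] exhaust it. *)
Lemma sum_antidiagonal (W : nmodType) n (c : nat -> nat -> W) :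
  (forall i j, (n <= i)%N || (n <= j)%N -> c i j = 0) ->
  \sum_(m < n + n) \sum_(i < m.+1) c i (m - i)%N = \sum_(i < n) \sum_(j < n) c i j.
Proof.
move=> c0; pose N := (n + n)%N.
have diag (m : 'I_N) : \sum_(i < m.+1) c i (m - i)%N =
    \sum_(i < n) \sum_(j < n | (i + j == m)%N) c i j.
  transitivity (\sum_(i < N | (i <= m)%N) c i (m - i)%N).
    by rewrite (big_ord_widen N (fun i => c i (m - i)%N)).
  transitivity (\sum_(i < N | (i < n)%N) \sum_(j < n | (i + j == m)%N) c i j); last first.
    by rewrite (big_ord_widen N (fun i => \sum_(j < n | (i + j == m)%N) c i j)) ?leq_addr.
  rewrite big_mkcond [RHS]big_mkcond /=; apply: eq_bigr => i _.
  have [ltin | leni] := ltnP i n; last by rewrite c0 ?leni ?if_same.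
  have [leim | ltmi] := leqP i m; last first.
    by rewrite big1 // => j /eqP ijm; move: ltmi; rewrite -ijm ltnNge leq_addr.
  have [ltmn | lenm] := ltnP (m - i)%N n.
    rewrite (big_pred1 (Ordinal ltmn)) // => j /=.
    by rewrite -val_eqE /= -[RHS](eqn_add2l i) subnKC.
  rewrite c0 ?lenm ?orbT // big1 // => j /eqP ijm.
  by move: lenm; rewrite -ijm addKn leqNgt ltn_ord.
rewrite (eq_bigr _ (fun m _ => diag m)) exchange_big /=; apply: eq_bigr => i _.
rewrite (exchange_big_dep predT) //=; apply: eq_bigr => j _.
have ltij : (i + j < N)%N by rewrite /N -addnS leq_add // ltnW.
by rewrite (big_pred1 (Ordinal ltij)) // => m; rewrite -val_eqE /= eq_sym.
Qed.

Section ExpBilinear.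
Variables (F : numFieldType) (U V W : lmodType F) (b : {bilinear U -> V -> W}).
Variables (DU : U -> U) (DV : V -> V) (DW : {linear W -> W}).
Hypothesis bD : forall u v, DW (b u v) = b (DU u) v + b u (DV v).

(** Leibniz rule for powers. The three operators may differ, so that the rule serves both for
    derivations of the bracket and for evaluation of endomorphisms. *)
Lemma iter_bilinear m u v : iter m DW (b u v) =
  \sum_(i < m.+1) 'C(m, i)%:R *: b (iter i DU u) (iter (m - i) DV v).
Proof.
elim: m => [|m IHm]; first by rewrite big_ord1 scale1r.
rewrite iterS {}IHm linear_sum /=.
under eq_bigr => i _ do rewrite linearZ /= bD scalerDr.
rewrite big_split /= [RHS]big_ord_recl subn0 bin0 scale1r.
under [in RHS]eq_bigr => i _ do rewrite binS natrD scalerDl lift0 subSS.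
rewrite big_split /= addrCA addrA addrC; congr (_ + _).
transitivity (\sum_(i < m.+2) 'C(m, i)%:R *: b (iter i DU u) (iter (m.+1 - i) DV v)).
  rewrite [RHS]big_ord_recr /= bin_small // scale0r addr0.
  by apply: eq_bigr => i _; rewrite -iterS subSn // -ltnS.
by rewrite big_ord_recl subn0 bin0 scale1r addrC.
Qed.

(** This is [exp(DW) (b u v) = b (exp(DU) u) (exp(DV) v)]; the truncation at [n + n] covers all
    products of nonzero terms. *)
Lemma exp_bilinear n u v :
    (forall k, (n <= k)%N -> iter k DU u = 0) ->
    (forall k, (n <= k)%N -> iter k DV v = 0) ->
  \sum_(k < n + n) (k`!%:R)^-1 *: iter k DW (b u v) =
  b (\sum_(k < n) (k`!%:R)^-1 *: iter k DU u)
    (\sum_(k < n) (k`!%:R)^-1 *: iter k DV v).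
Proof.
move=> DU0 DV0; pose c i j :=
  (i`!%:R : F)^-1 *: ((j`!%:R : F)^-1 *: b (iter i DU u) (iter j DV v)).
transitivity (\sum_(m < n + n) \sum_(i < m.+1) c i (m - i)%N).
  apply: eq_bigr => m _; rewrite iter_bilinear scaler_sumr; apply: eq_bigr => i _.
  rewrite /c !scalerA; congr (_ *: _).
  have lim : (i <= m)%N by rewrite -ltnS.
  apply: (mulfI (x := m`!%:R)); first by rewrite pnatr_eq0 -lt0n fact_gt0.
  rewrite mulrA mulfV ?mul1r; last by rewrite pnatr_eq0 -lt0n fact_gt0.
  rewrite -(bin_fact lim) !natrM -invfM mulfK //.
  by rewrite -natrM pnatr_eq0 -lt0n muln_gt0 !fact_gt0.
rewrite sum_antidiagonal => [|i j].
  rewrite linear_sumlz; apply: eq_bigr => i _.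
  rewrite linear_sumr; apply: eq_bigr => j _.
  by rewrite linearZl_LR linearZr_LR.
by case/orP=> [/DU0 | /DV0] E; rewrite /c E ?linear0l ?linear0r !scaler0.
Qed.

End ExpBilinear.

Section LfunEval.
Variables (F : fieldType) (V : vectType F).

(** Evaluation as a bilinear pairing, so that [exp_bilinear] can compute the composite of two
    exponentials. *)
Definition lfun_eval (f : 'End(V)) (v : V) := f v.

Lemma lfun_eval_bilinear : bilinear_for
  (GRing.Scale.Law.clone _ _ *:%R _) (GRing.Scale.Law.clone _ _ *:%R _) lfun_eval.
Proof.
split=> [v a f g | f a v w]; rewrite /lfun_eval; last exact: linearP.
by rewrite add_lfunE scale_lfunE.
Qed.

HB.instance Definition _ :=
  bilinear_isBilinear.Build F 'End(V) V V _ _ lfun_eval lfun_eval_bilinear.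

End LfunEval.

Section ExpNilp.
Variables (F : numFieldType) (V : vectType F).
Implicit Types f g : 'End(V).

Lemma exp_sumE f n v :
  (\sum_(k < n) (k`!%:R)^-1 *: lfun_exp f k) v =
  \sum_(k < n) (k`!%:R)^-1 *: iter k f v.
Proof.
by rewrite sum_lfunE; apply: eq_bigr => k _; rewrite scale_lfunE lfun_expE.
Qed.

Lemma exp_sum_widen f n N v : (n <= N)%N -> lfun_exp f n = 0 ->
  \sum_(k < N) (k`!%:R)^-1 *: iter k f v = \sum_(k < n) (k`!%:R)^-1 *: iter k f v.
Proof.
move=> lenN fn0; rewrite [RHS](big_ord_widen N (fun k => (k`!%:R)^-1 *: iter k f v)) //.
rewrite [RHS]big_mkcond; apply: eq_bigr => k _; case: ltnP => // lenk.
by rewrite (iter_lfun_eq0 lenk) ?scaler0 // -lfun_expE fn0 zero_lfunE.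
Qed.

Lemma exp_nilpE f g n v : lfun_exp f n = 0 -> exp_nilp f g ->
  g v = \sum_(k < n) (k`!%:R)^-1 *: iter k f v.
Proof.
move=> fn [m fm ->]; rewrite exp_sumE -(exp_sum_widen _ (leq_maxl m n)) //.
by rewrite (exp_sum_widen _ (leq_maxr m n)).
Qed.

Lemma lfun_exp_opp f n : lfun_exp f n = 0 -> lfun_exp (- f) n = 0.
Proof.
move=> fn; apply/lfunP=> v; rewrite lfun_expE -scaleN1r iter_scale_lfun.
by rewrite -lfun_expE fn !zero_lfunE scaler0.
Qed.

(** For the evaluation pairing, take composition with [f] on endomorphisms and [- f] on vectors. The
    two contributions cancel, so [DW] is [0] and its exponential is the identity. *)
Lemma exp_nilp_opp f g : exp_nilp f g ->
  exists2 g', exp_nilp (- f) g' & forall v, g (g' v) = v.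
Proof.
case=> n fn0 gE; have Nfn0 := lfun_exp_opp fn0.
exists (\sum_(k < n) (k`!%:R)^-1 *: lfun_exp (- f) k) => [|v]; first by exists n.
have compD (h : 'End(V)) u : (0 : 'End(V)) (lfun_eval h u) =
    lfun_eval (h \o f)%VF u + lfun_eval h ((- f) u).
  by rewrite zero_lfunE /lfun_eval comp_lfunE opp_lfunE linearN subrr.
have itercomp k : iter k (fun h => (h \o f)%VF) \1%VF = lfun_exp f k.
  elim: k => //= k ->; apply/lfunP=> u.
  by rewrite !comp_lfunE !lfun_expE -iterSr.
have := exp_bilinear (b := lfun_eval (V := V)) compD (n := n) (u := \1%VF) (v := v).
rewrite /= /lfun_eval; under [in RHS]eq_bigr => k _ do rewrite itercomp.
rewrite -gE exp_sumE => expE; rewrite -{}expE.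
(* If [n] is [0], the identity is zero and the space is trivial; otherwise only the term [k = 0]
   survives. *)
- case: n fn0 {gE Nfn0} => [fn0 | n _].
    by rewrite big_ord0 -[RHS]id_lfunE (fn0 : \1%VF = 0) zero_lfunE.
  rewrite addSn big_ord_recl /= id_lfunE invr1 scale1r big1 ?addr0 // => i _.
  by rewrite zero_lfunE scaler0.
- move=> k lenk; rewrite itercomp; apply/lfunP=> u.
  rewrite lfun_expE (iter_lfun_eq0 lenk) ?zero_lfunE //.
  by rewrite -lfun_expE fn0 zero_lfunE.
- by move=> k lenk; rewrite (iter_lfun_eq0 lenk) // -lfun_expE Nfn0 zero_lfunE.
Qed.

Lemma exp_nilp_unique f g g' : exp_nilp f g -> exp_nilp f g' -> g = g'.
Proof.
move=> fg fg'; have [n fn0 _] := fg.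
by apply/lfunP=> v; rewrite (exp_nilpE v fn0 fg) (exp_nilpE v fn0 fg').
Qed.

Lemma exp_nilp_inv f g : exp_nilp f g ->
  exists2 g', exp_nilp (- f) g' & cancel g g' /\ cancel g' g.
Proof.
move=> fg; have [g' fg' gK'] := exp_nilp_opp fg; exists g' => //; split=> // v.
have [g''] := exp_nilp_opp fg'; rewrite opprK => /(exp_nilp_unique fg) <-; exact.
Qed.

Lemma exp_nilp_automorphism (mu : {bilinear V -> V -> V}) f g :
    (forall x y, f (mu x y) = mu (f x) y + mu x (f y)) ->
  exp_nilp f g -> automorphism mu g.
Proof.
move=> fD fg; split.
  by have [g' _ [/can_inj gI _]] := exp_nilp_inv fg; apply/eqP/lker0P.
have [n fn0 _] := fg => x y.
have fk0 z k : (n <= k)%N -> iter k f z = 0.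
  by move=> lenk; rewrite (iter_lfun_eq0 lenk) // -lfun_expE fn0 zero_lfunE.
rewrite !(exp_nilpE _ fn0 fg) -(exp_bilinear fD) //; try by move=> k /fk0.
by rewrite (exp_sum_widen _ (leq_addr n n)).
Qed.

End ExpNilp.

(** * Leibniz algebras *)

Section LeibnizAlgebra.
Variables (F : numClosedFieldType) (L : vectType F) (mu : {bilinear L -> L -> L}).
Hypothesis leib : leibniz_identity mu.
Implicit Types (x y z a v : L) (f g : 'End(L)).

Local Notation R := (rmul mu).

Lemma rmul_is_linear : linear R.
Proof.
move=> k x y; apply/lfunP=> v.
by rewrite add_lfunE scale_lfunE !rmulE linearPr.
Qed.

HB.instance Definition _ := GRing.isLinear.Build F L 'End(L) _ R rmul_is_linear.

Lemma rmulD x y : R (x + y) = R x + R y.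
Proof. exact: linearD. Qed.

Lemma rmulZ k x : R (k *: x) = k *: R x.
Proof. exact: linearZ. Qed.

Lemma rmulB x y : R (x - y) = R x - R y.
Proof. exact: linearB. Qed.

Lemma rmul_derivation z x y : R z (mu x y) = mu (R z x) y + mu x (R z y).
Proof. by rewrite !rmulE leib addrC subrK. Qed.

(** Exchanging [x] and [y] changes the sign of one side of the Leibniz identity. Thus
    [mu x y + mu y x] is right central, which replaces antisymmetry. *)
Lemma mulC_right v x y : mu v (mu x y) = - mu v (mu y x).
Proof. by rewrite !leib opprB. Qed.

Definition right_center : {vspace L} := lker (linfun R).

Lemma right_centerP z : reflect (R z = 0) (z \in right_center).
Proof. by rewrite memv_ker lfunE; apply: eqP. Qed.

Lemma sub_shift_bracket f l m x y :
    (forall x y, f (mu x y) = mu (f x) y + mu x (f y)) ->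
  (f - (l + m) *: \1%VF) (mu x y) =
  mu ((f - l *: \1%VF) x) y + mu x ((f - m *: \1%VF) y).
Proof.
move=> fD; rewrite !sub_scalarE fD scalerDl linearBl linearBr linearZl_LR linearZr_LR /=.
by rewrite opprD addrACA.
Qed.

(** [f - (l + m)] obeys a product rule with [f - l] on [x] and [f - m] on [y], so each application
    lowers one of the nilpotency orders [i] and [j]. *)
Lemma geneigenspace_bracket f l m x y :
    (forall x y, f (mu x y) = mu (f x) y + mu x (f y)) ->
  x \in geneigenspace f l -> y \in geneigenspace f m ->
  mu x y \in geneigenspace f (l + m).
Proof.
move=> fD /null_componentP[i xi] /null_componentP[j yj].
apply/null_componentP; exists (i + j)%N.
have: (i + j <= i + j)%N by []; move: {2 3}(i + j)%N => n.
elim: n i j x y xi yj => [|n IHn] [|i] [|j] x y xi yj // leijn;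
  try by rewrite [x]xi linear0l iter_lfun0.
  by rewrite [y]yj linear0r iter_lfun0.
rewrite iterSr sub_shift_bracket // iter_lfunD.
rewrite (IHn i j.+1 _ _ _ yj leijn) ?add0r -?iterSr //.
by apply: (IHn i.+1 j _ _ xi); rewrite -?iterSr // -ltnS -addnS.
Qed.

(** [R x] shifts the generalized eigenvalues of [R a] by [l]. Among the [size s + 1] distinct values
    [m + k l] with [k <= size s], one lies outside [s], where the generalized eigenspace is zero. *)
Lemma rmul_nilpotent a l x : l != 0 -> x \in geneigenspace (R a) l ->
  exists n, lfun_exp (R x) n = 0.
Proof.
move=> l0 xl; have [s sE] := annihilating_roots (R a).
exists (size s); apply/lfunP=> v; rewrite zero_lfunE lfun_expE.
have: v \in (\sum_(m <- s) geneigenspace (R a) m)%VS.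
  by rewrite geneigenspace_sum ?memvf.
suff: (\sum_(m <- s) geneigenspace (R a) m <= lker (lfun_exp (R x) (size s)))%VS.
  by move=> /subvP sub /sub; rewrite memv_ker lfun_expE => /eqP.
elim/big_rec: _ => [|m U _ IH]; first exact: sub0v.
rewrite subv_add IH andbT; apply/subvP=> u um; rewrite memv_ker lfun_expE.
have iterx k : iter k (R x) u \in geneigenspace (R a) (m + k%:R * l).
  elim: k => [|k IHk]; first by rewrite mul0r addr0.
  rewrite iterS rmulE -[k.+1]addn1 natrD mulrDl mul1r addrA.
  exact: geneigenspace_bracket (rmul_derivation a) IHk xl.
have [/hasP[k]|] := boolP (has (fun k => m + k%:R * l \notin s) (iota 0 (size s).+1)).
  rewrite mem_iota ltnS /= => lek ks.
  by rewrite (iter_lfun_eq0 lek) // (geneigenspace_notin sE (iterx k) ks).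
rewrite -all_predC => /allP sub.
have: (size [seq (m + k%:R * l)%R | k <- iota 0 (size s).+1] <= size s)%N.
  apply: uniq_leq_size.
    rewrite map_inj_uniq ?iota_uniq // => i j /addrI /(mulIf l0) /eqP.
    by rewrite eqr_nat => /eqP.
  by move=> _ /mapP[k /sub /= + ->]; rewrite negbK.
by rewrite size_map size_iota ltnn.
Qed.

Lemma rmul_add_right_center a z : z \in right_center -> R (a + z) = R a.
Proof. by move=> /right_centerP z0; rewrite rmulD z0 addr0. Qed.

Lemma null_component_mul a x y : x \in null_component (R a) ->
  y \in null_component (R a) -> mu x y \in null_component (R a).
Proof.
rewrite -!geneigenspace0 => x0 y0; rewrite -[0]addr0.
exact: geneigenspace_bracket (rmul_derivation a) x0 y0.
Qed.

Lemma geneigenspace_sub_img f l : l != 0 -> (geneigenspace f l <= limg f)%VS.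
Proof.
move=> l0; apply/subvP=> u ul; have [w _] := geneigenspace_solve l0 ul.
by rewrite scale0r subr0 => <-; rewrite memv_img ?memvf.
Qed.

(** The list joins bases of the generalized eigenspaces of [R a] for the nonzero members of [s]. *)
Lemma root_vectors a : exists es : seq L,
  (forall e, e \in es -> exists n, lfun_exp (R e) n = 0) /\
  (null_component (R a) + <<es>>)%VS = fullv.
Proof.
have [s sE] := annihilating_roots (R a).
exists (flatten [seq vbasis (geneigenspace (R a) l) : seq L | l <- s & l != 0]); split.
  move=> e /flatten_mapP[l]; rewrite mem_filter => /andP[l0 _] /vbasis_mem.
  exact: rmul_nilpotent.
apply: subv_anti; rewrite subvf -(geneigenspace_sum sE) /=.
elim: (s) => [|m t IHt]; first by rewrite big_nil sub0v.
rewrite big_cons subv_add /=; have [->|m0] := eqVneq m 0.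
  by rewrite geneigenspace0 addvSl.
rewrite /= span_cat (span_basis (vbasisP _)).
rewrite (subv_trans (addvSl _ _) (addvSr _ _)) /=.
by apply: subv_trans IHt _; rewrite addvS ?addvSr.
Qed.

Lemma null_component_add_limg f : (null_component f + limg f)%VS = fullv.
Proof.
have [s sE] := annihilating_roots f.
apply: subv_anti; rewrite subvf -[X in (X <= _)%VS](geneigenspace_sum sE) /=.
elim/big_rec: _ => [|m U _ IH]; first exact: sub0v.
rewrite subv_add IH andbT; have [->|m0] := eqVneq m 0.
  by rewrite geneigenspace0 addvSl.
exact: subv_trans (geneigenspace_sub_img f m0) (addvSr _ _).
Qed.

(** This gives the surjectivity of the derivative in the orbit argument. Modulo the null component,
    the image of [R a] consists of the [mu u a] with [u] in the span of [es], and [mu u a] is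
    [- mu a u] up to the right center. *)
Lemma tangent_span a es : (null_component (R a) + <<es>>)%VS = fullv ->
  (null_component (R a) + (<<[seq mu a e | e <- es]>> + right_center))%VS = fullv.
Proof.
move=> esP; apply: subv_anti; rewrite subvf -(null_component_add_limg (R a)) subv_add addvSl /=.
apply/subvP=> _ /memv_imgP[w _ ->].
have /memv_addP[h h0 [u ues ->]]: w \in (null_component (R a) + <<es>>)%VS by rewrite esP memvf.
rewrite linearD memv_add ?null_component_stable //= rmulE.
rewrite -[mu u a](addKr (mu a u)) memv_add //.
  rewrite memvN.
  have := memv_img (linfun (mu a)) ues; rewrite limg_span lfunE.
  by rewrite (eq_map (g := mu a)) // => e; rewrite lfunE.
by apply/right_centerP/lfunP=> v; rewrite zero_lfunE rmulE linearDr mulC_right addNr.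
Qed.

End LeibnizAlgebra.

(** * Polynomial families of endomorphisms *)

Lemma poly_nonroot_inj (F : idomainType) (f : nat -> F) (p : {poly F}) :
  injective f -> p != 0 -> exists i, p.[f i] != 0.
Proof.
move=> finj p0.
have [/hasP[i _ pi]|] := boolP (has (fun i : nat => p.[f i] != 0) (iota 0 (size p))).
  by exists i.
rewrite -all_predC => /allP allr.
have: (size [seq f i | i <- iota 0 (size p)] < size p)%N.
  apply: max_poly_roots => //.
    by apply/allP=> _ /mapP[i /allr /= + ->]; rewrite negbK.
  by rewrite map_inj_uniq ?iota_uniq.
by rewrite size_map size_iota ltnn.
Qed.

Lemma poly_nonroot (F : numDomainType) (p : {poly F}) : p != 0 -> exists t, p.[t] != 0.
Proof.
have natr_inj : injective (fun i : nat => i%:R : F).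
  by move=> i j /eqP; rewrite eqr_nat => /eqP.
by move=> /(poly_nonroot_inj natr_inj)[i pi]; exists i%:R.
Qed.

Section PolynomialFamily.
Variables (F : numFieldType) (V : vectType F).
Implicit Types (A B : F -> 'End(V)) (f g : 'End(V)).

Lemma mul_f2mx f (u : 'rV_(dim V)) : u *m f2mx f = v2r (f (r2v u)).
Proof. by rewrite unlock /= !r2vK. Qed.

Lemma f2mx_comp f g : f2mx (f \o g)%VF = f2mx g *m f2mx f.
Proof.
by apply/row_matrixP=> i; rewrite !rowE mulmxA !mul_f2mx comp_lfunE v2rK.
Qed.

Lemma dim_lker f : \dim (lker f) = (dim V - \rank (f2mx f))%N.
Proof. by rewrite -mxrank_ker /dimv mx2vsK. Qed.

Definition polynomial_family A : Prop := exists P : 'M[{poly F}]_(dim V),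
  forall t, f2mx (A t) = map_mx (horner_eval t) P.

Lemma polynomial_family_const f : polynomial_family (fun=> f).
Proof.
exists (map_mx polyC (f2mx f)) => t; rewrite -map_mx_comp map_mx_id //.
by move=> c /=; rewrite /horner_eval hornerC.
Qed.

Lemma polynomial_family_affine f g : polynomial_family (fun t => f + t *: g).
Proof.
exists (map_mx polyC (f2mx f) + 'X *: map_mx polyC (f2mx g)) => t.
apply/row_matrixP=> i; rewrite !rowE mul_f2mx add_lfunE scale_lfunE linearD linearZ /=.
rewrite -!mul_f2mx -linearZ -mulmxDr; congr (_ *m _).
by apply/matrixP=> j k; rewrite !mxE /horner_eval !hornerE.
Qed.

Lemma polynomial_family_comp A B : polynomial_family A -> polynomial_family B ->
  polynomial_family (fun t => A t \o B t)%VF.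
Proof.
by case=> P PE [Q QE]; exists (Q *m P) => t; rewrite f2mx_comp PE QE map_mxM.
Qed.

Lemma polynomial_family_exp A n : polynomial_family A ->
  polynomial_family (fun t => lfun_exp (A t) n).
Proof.
move=> PA; elim: n => [|n IHn]; first exact: polynomial_family_const.
exact: polynomial_family_comp.
Qed.

(** With [r] the rank at [t0], [U] and [W] make [U A(t0) W] the identity of size [r]. Where the
    polynomial [p], the determinant of [U A(t) W], is nonzero, the rank of [A t] is at least [r]. *)
Lemma lker_semicontinuous A t0 : polynomial_family A ->
  exists2 p : {poly F}, p.[t0] != 0 &
    forall t, p.[t] != 0 -> (\dim (lker (A t)) <= \dim (lker (A t0)))%N.
Proof.
case=> P PE; set M := f2mx (A t0).
have [U UM] := row_fullP (col_base_full M).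
have [W MW] := row_freeP (row_base_free M).
pose p := \det (map_mx polyC U *m P *m map_mx polyC W).
have pE t : p.[t] = \det (U *m f2mx (A t) *m W).
  rewrite -[LHS]/(horner_eval t p) -det_map_mx !map_mxM PE.
  by congr (\det (_ *m _ *m _)); apply/matrixP=> i j; rewrite !mxE /= /horner_eval hornerC.
exists p => [|t]; rewrite pE.
  have -> : U *m f2mx (A t0) *m W = 1%:M by rewrite -[f2mx _](mulmx_base M) mulmxA UM mul1mx MW.
  by rewrite det1 oner_eq0.
rewrite -unitfE -[_ \is a _]/(_ \in unitmx) => /mxrank_unit rk.
rewrite !dim_lker leq_sub2l // -/M -rk.
by apply: leq_trans (mxrankM_maxl _ _) (mxrankM_maxr _ _).
Qed.

Lemma iter_affine f g v n : exists2 u : nat -> V, u n = iter n g v &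
  forall t, iter n (f + t *: g) v = \sum_(k < n.+1) t ^+ k *: u k.
Proof.
elim: n => [|n [u un uE]]; first by exists (fun=> v) => // t; rewrite big_ord1 scale1r.
exists (fun k => (if (k <= n)%N then f (u k) else 0) + (if k is j.+1 then g (u j) else 0)).
  by rewrite ltnn add0r un.
move=> t; rewrite iterS {}uE add_lfunE scale_lfunE !linear_sum /=.
under [in RHS]eq_bigr => k _ do rewrite scalerDr.
rewrite big_split /=; congr (_ + _).
  rewrite [RHS]big_ord_recr /= ltnn scaler0 addr0.
  by apply: eq_bigr => k _; rewrite linearZ /= -ltnS ltn_ord.
rewrite [RHS]big_ord_recl /= scaler0 add0r; apply: eq_bigr => k _.
by rewrite linearZ scalerA /= exprS.
Qed.

(** Each coordinate of [(f + t g)^n v] is a polynomial in [t] that vanishes wherever [p] does not,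
    hence is zero; its coefficient of degree [n] comes from [g^n v]. *)
Lemma affine_nilpotent_lead f g v n (p : {poly F}) : p != 0 ->
    (forall t, p.[t] != 0 -> iter n (f + t *: g) v = 0) ->
  iter n g v = 0.
Proof.
move=> p0 fg0; have [u <- uE] := iter_affine f g v n.
apply: v2r_inj; apply/rowP=> j; rewrite linear0 mxE.
pose q := \poly_(k < n.+1) v2r (u k) 0 j.
have qE t : q.[t] = v2r (iter n (f + t *: g) v) 0 j.
  rewrite uE horner_poly linear_sum summxE; apply: eq_bigr => k _.
  by rewrite linearZ mxE mulrC.
have q0 : q == 0.
  apply: contraT => q0; have [t] := poly_nonroot (mulf_neq0 q0 p0).
  rewrite hornerM mulf_eq0 negb_or => /andP[+ /fg0 E].
  by rewrite qE E linear0 mxE eqxx.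
by have := coef0 F n; rewrite -(eqP q0) coef_poly ltnSn.
Qed.

End PolynomialFamily.

(** * Invariant automorphisms *)

Section InvariantAutomorphisms.
Variables (F : numClosedFieldType) (L : vectType F) (mu : {bilinear L -> L -> L}).
Hypothesis leib : leibniz_identity mu.
Implicit Types (x y z a v : L) (f g d : 'End(L)) (U W : {vspace L}).

Local Notation R := (rmul mu).
Local Notation G := (invariant_automorphism mu).

Lemma invariant_exp x g : exp_nilp (R x) g -> G g.
Proof.
move=> xg; rewrite -[g]comp_lfun1r; apply: (Defs.invariant_comp (g := g) xg _ (invariant_id mu)).
exact: exp_nilp_automorphism (rmul_derivation leib x) xg.
Qed.

Lemma invariant_automorphism_comp f g : G f -> G g -> G (f \o g)%VF.
Proof.
move=> Gf Gg; elim: Gf => [|x h f' xh auth _ IH]; first by rewrite comp_lfun1l.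
by rewrite -comp_lfunA; apply: Defs.invariant_comp xh auth IH.
Qed.

Lemma invariant_automorphism_inv f : G f -> exists2 g, G g & cancel f g /\ cancel g f.
Proof.
elim=> [|x h f' xh _ _ [g Gg [fK gK]]].
  by exists \1%VF; [exact: invariant_id | split=> v; rewrite !id_lfunE].
have [h' xh' [hK h'K]] := exp_nilp_inv xh.
have Gh' : G h' by apply: (@invariant_exp (- x)); rewrite linearN.
exists (g \o h')%VF; first exact: invariant_automorphism_comp.
by split=> v; rewrite !comp_lfunE /= ?hK ?fK ?gK ?h'K.
Qed.

Lemma invariant_automorphismP f : G f -> automorphism mu f.
Proof.
elim=> [|x h f' _ [h0 hM] _ [f0 fM]].
  by split=> [|u v]; rewrite ?id_lfunE //; apply/eqP/lker0P=> u v; rewrite !id_lfunE.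
split=> [|u v]; last by rewrite !comp_lfunE fM hM.
apply/eqP/lker0P => u v; rewrite !comp_lfunE.
by move/eqP: h0 => /lker0P hI /hI; move/eqP: f0 => /lker0P; apply.
Qed.

Definition conjugate U W := exists2 d, G d & (d @: U)%VS = W.

Lemma conjugate_trans U V W : conjugate U V -> conjugate V W -> conjugate U W.
Proof.
case=> d Gd <- [d' Gd' <-]; exists (d' \o d)%VF; last exact: limg_comp.
exact: invariant_automorphism_comp.
Qed.

Lemma conjugate_sym U W : conjugate U W -> conjugate W U.
Proof.
case=> d Gd <-; have [d' Gd' [dK _]] := invariant_automorphism_inv Gd.
exists d' => //; rewrite -limg_comp -[RHS]lim1g; congr (_ @: _)%VS.
by apply/lfunP=> v; rewrite comp_lfunE id_lfunE dK.
Qed.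

Lemma conjugate_dim U W : conjugate U W -> \dim U = \dim W.
Proof.
case=> d /invariant_automorphismP[d0 _] <-.
by rewrite limg_dim_eq // d0 capv0.
Qed.

Lemma invariant_null_component d x : G d ->
  (d @: null_component (R x))%VS = null_component (R (d x)).
Proof.
move=> Gd; have [_ dM] := invariant_automorphismP Gd.
have [d' _ [dK d'K]] := invariant_automorphism_inv Gd.
have iterd k v : d (iter k (R x) v) = iter k (R (d x)) (d v).
  by elim: k => //= k <-; rewrite !rmulE dM.
apply/vspaceP=> w; apply/memv_imgP/idP => [[v /null_componentP[k xv] ->] | /null_componentP[k xw]].
  by apply/null_componentP; exists k; rewrite -iterd xv linear0.
exists (d' w); rewrite ?d'K //; apply/null_componentP; exists k.
by apply: (can_inj dK); rewrite iterd d'K xw linear0.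
Qed.

(** [M] is stable under every [R (a + t h)], so [A t] kills [M], and the kernel of [A 0] is exactly
    [M]. By semicontinuity the kernel of [A t] is [M] for almost all [t]; it contains the null
    component of [R (a + t h)], which equals [M] by minimality. Nilpotency of [R a + t R h] on [M]
    for these [t] passes to [R h]. *)
Lemma null_component_generic (S : {vspace L}) a :
    a \in S -> (S <= null_component (R a))%VS ->
    (forall x, x \in S -> (\dim (null_component (R a)) <= \dim (null_component (R x)))%N) ->
  forall h, h \in S -> (null_component (R a) <= null_component (R h))%VS.
Proof.
move=> aS /subvP Sa amin h hS; set M := null_component (R a) in Sa amin *.
pose n := dim L; pose A t := (lfun_exp (R a) n \o lfun_exp (R a + t *: R h) n)%VF.
have famA : polynomial_family A.
  apply: polynomial_family_comp; first exact: polynomial_family_const.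
  exact/polynomial_family_exp/polynomial_family_affine.
have [p p0 pE] := lker_semicontinuous 0 famA.
have A0 : lker (A 0) = M.
  apply/vspaceP=> v; rewrite memv_ker comp_lfunE scale0r addr0 !lfun_expE.
  by rewrite -null_componentE null_component_iter.
have RS t : R a + t *: R h = R (a + t *: h) by rewrite rmulD rmulZ.
have Mstable t k v : v \in M -> iter k (R a + t *: R h) v \in M.
  rewrite RS => vM; elim: k => //= k IHk; rewrite rmulE.
  by apply: null_component_mul => //; apply: Sa; rewrite memvD ?memvZ.
have AM t : p.[t] != 0 -> null_component (R a + t *: R h) = M.
  move=> pt; have lkA : lker (A t) = M.
    apply/esym/eqP; rewrite eqEdim -[in X in _ && X]A0 pE // andbT.
    apply/subvP=> v vM; rewrite memv_ker comp_lfunE !lfun_expE -null_componentE.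
    exact: Mstable.
  apply/eqP; rewrite eqEdim RS amin ?memvD ?memvZ // andbT -lkA.
  by apply/subvP=> v; rewrite -RS !memv_ker comp_lfunE => /eqP->; rewrite linear0.
apply/subvP=> v vM; rewrite null_componentE; apply/eqP.
apply: (@affine_nilpotent_lead _ _ (R a) _ _ _ p) => [|t /AM AtM].
  by apply: contraNneq p0 => ->; rewrite horner0.
by apply/eqP; rewrite -null_componentE AtM.
Qed.

End InvariantAutomorphisms.

(** * Cartan subalgebras *)

Lemma exists_argmin (T : Type) (P : T -> Prop) (m : T -> nat) x0 : P x0 ->
  exists2 a, P a & forall x, P x -> (m a <= m x)%N.
Proof.
move=> Px0; have exm : exists n, `[< exists2 x, P x & m x = n >].
  by exists (m x0); apply/asboolP; exists x0.
case: (ex_minnP exm) => n /asboolP[a Pa <-] amin; exists a => // x Px.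
by apply: amin; apply/asboolP; exists x.
Qed.

Section Cartan.
Variables (F : numClosedFieldType) (L : vectType F) (mu : {bilinear L -> L -> L}).
Hypothesis leib : leibniz_identity mu.
Implicit Types (x y z a v : L) (H M : {vspace L}).

Local Notation R := (rmul mu).
Local Notation lp := (lower_power mu).

Lemma lower_power_decr H k : subalgebra mu H -> (lp H k.+1 <= lp H k)%VS.
Proof.
move=> Hsub; elim: k => [|k /subvP IHk]; first exact/bracketv_subP.
by apply/bracketv_subP=> x y /IHk; apply: memv_bracket.
Qed.

Lemma lower_power_sub H k : subalgebra mu H -> (lp H k <= H)%VS.
Proof.
move=> Hsub; elim: k => [|k IHk]; first exact: subvv.
exact: subv_trans (lower_power_decr k Hsub) IHk.
Qed.

Lemma nilpotent_subalgebra_null H : nilpotent_subalgebra mu H ->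
  forall h, h \in H -> (H <= null_component (R h))%VS.
Proof.
move=> [n Hn] h hH; apply/subvP=> x xH; apply/null_componentP; exists n; apply/eqP.
rewrite -memv0 -Hn; elim: (n) => //= k IHk.
by rewrite rmulE; apply: memv_bracket.
Qed.

(* Engel's theorem for the action of [H] on [M / H], by descending induction
   along the lower central series of [H]. *)
Lemma nilpotent_normalizer_growth H M :
    subalgebra mu H -> nilpotent_subalgebra mu H ->
    (forall x h, x \in M -> h \in H -> mu x h \in M) ->
    (forall h, h \in H -> (M <= null_component (R h))%VS) ->
    ~~ (M <= H)%VS ->
  exists2 x, x \notin H & left_normalizer mu H x.
Proof.
move=> Hsub [n Hn] MH Mnil /subvPn[x0 x0M x0H].
(* [X 0] implies that [x] normalizes [H], and [X n] holds on all of [M] because [lp H n] is zero;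
   the descent goes from [X k.+1] to [X k]. *)
pose X k x := x \in M /\ forall g, g \in lp H k -> mu x g \in H.
suff: exists2 x, x \notin H & X 0%N x by case=> x xH [_ xn]; exists x.
have: exists2 x, x \notin H & X n x.
  by exists x0 => //; split=> // g; rewrite Hn memv0 => /eqP->; rewrite linear0r mem0v.
elim: n {Hn} => // k IHk [x xH Xx]; apply: IHk.
have Xstable z h : X k.+1 z -> h \in H -> X k.+1 (mu z h).
  move=> [zM zX] hH; split=> [|g gk]; first exact: MH.
  have -> : mu (mu z h) g = mu z (mu h g) + mu (mu z g) h by rewrite leib subrK.
  (* Lower powers are formed by bracketing with [H] on the right, so [mu h g] is turned into
     [- mu g h]. *)
  rewrite mulC_right //; apply: memvD; last by apply: Hsub (zX g gk) hH.
  have gh : mu g h \in lp H k.+2 by apply: memv_bracket.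
  by rewrite memvN zX // (subvP (lower_power_decr k.+1 Hsub)).
(* Basis vectors [g] of [lp H k] are treated one at a time: [z] is replaced by its last iterate
   under [R g] outside [H], which exists since [R g] is nilpotent on [M]. *)
have [y yH [[yM yX] yk]] : exists2 y, y \notin H &
    X k.+1 y /\ forall g, g \in (vbasis (lp H k) : seq L) -> mu y g \in H.
  have: {subset (vbasis (lp H k) : seq L) <= lp H k} by move=> g /vbasis_mem.
  elim: (vbasis _ : seq L) => [|g gs IHgs] gsub; first by exists x.
  have [z|z zH [zX zgs]] := IHgs; first by move=> zgs; rewrite gsub // inE zgs orbT.
  have gk : g \in lp H k by rewrite gsub ?mem_head.
  have gH := subvP (lower_power_sub k Hsub) _ gk.
  (* Iterating [R g] preserves what holds for the vectors [g'] already treated, because [mu g g']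
     lies in [lp H k.+1]. *)
  have itX i : X k.+1 (iter i (R g) z) /\
      forall g', g' \in gs -> mu (iter i (R g) z) g' \in H.
    elim: i => // i [IX IH]; rewrite iterS rmulE; split; first exact: Xstable.
    move=> g' gs'; have g'H : g' \in H.
      by apply: (subvP (lower_power_sub k Hsub)); rewrite gsub // inE gs' orbT.
    set w := iter i _ _ in IX IH *.
    have -> : mu (mu w g) g' = mu w (mu g g') + mu (mu w g') g by rewrite leib subrK.
    by apply: memvD; [apply: IX.2; apply: memv_bracket | apply: Hsub (IH _ gs') gH].
  have exH : exists i, iter i (R g) z \in H.
    have [zM _] := zX; have /subvP/(_ _ zM)/null_componentP[i iz] := Mnil _ gH.
    by exists i; rewrite iz mem0v.
  case: (ex_minnP exH) => -[|i] iH imin; first by rewrite /= (negPf zH) in iH.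
  exists (iter i (R g) z); first by apply/negP=> /imin; rewrite ltnn.
  have [IX IH] := itX i; split=> // g'; rewrite inE => /predU1P[-> | /IH //].
  by rewrite -rmulE.
exists y => //; split=> // g /coord_vbasis->.
rewrite linear_sumr memv_suml // => i _; rewrite linearZr_LR memvZ // yk //.
by rewrite mem_nth ?size_tuple.
Qed.

(** Minimality of [a] makes every [R h] nilpotent on its null component; were this larger than [H],
    some [x] outside [H] would normalize [H]. *)
Lemma cartan_null_component H : cartan_subalgebra mu H ->
  exists2 a, a \in H & null_component (R a) = H.
Proof.
case=> Hsub Hnil Hnorm.
have [a aH amin] := 
  @exists_argmin L (fun x => x \in H) (fun x => \dim (null_component (R x))) 0 (mem0v H).
have nullH := nilpotent_subalgebra_null Hnil.
have Mnil := null_component_generic leib aH (nullH _ aH) amin.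
exists a => //; apply/eqP; rewrite eqEsubv nullH // andbT; apply: contraT => sMH.
have [|x xH xn] := nilpotent_normalizer_growth Hsub Hnil _ Mnil sMH.
  move=> x h xM hH; apply: null_component_mul => //.
  exact: (subvP (nullH _ aH)).
by move/Hnorm: xn; rewrite (negPf xH).
Qed.

End Cartan.

(** * Norms and completeness *)

Section Completeness.
Variable R : realType.

Local Notation geo k := ((2^-1 : R) ^+ k).

Lemma geo_small (M y : R) : (forall k, y <= M * geo k) -> y <= 0.
Proof.
move=> yM; rewrite leNgt; apply/negP => y0.
have M0 : 0 < M by have := yM 0%N; rewrite mulr1; lra.
have [k kP] : exists k : nat, M / y < k%:R.
  by exists (Num.bound (M / y)); apply: archi_boundP; rewrite ltW ?divr_gt0.
have k2 : k%:R <= 2 ^+ k :> R.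
  by rewrite -natrX ler_nat; apply/ltnW/ltn_expl.
have := yM k; rewrite exprVn ler_pdivlMr ?exprn_gt0 // leNgt => /negP; apply.
by rewrite mulrC -ltr_pdivrMr // (lt_le_trans kP).
Qed.

(* The sequences [a k -/+ 2 C / 2 ^ k] are monotone in opposite directions. *)
Lemma real_geo_cvg (a : nat -> R) C : (forall k, `|a k.+1 - a k| <= C * geo k) ->
  exists s, forall k, `|a k - s| <= 2 * C * geo k.
Proof.
move=> aC; have C0 : 0 <= C by have := aC 0%N; rewrite mulr1; apply: le_trans.
have step k i : `|a (k + i)%N - a k| <= 2 * C * (geo k - geo (k + i)).
  elim: i => [|i IHi]; first by rewrite addn0 !subrr normr0 mulr0.
  have := aC (k + i)%N; rewrite addnS exprS.
  move: IHi; rewrite !ler_norml => /andP[] + + /andP[].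
  move: (geo _) (geo _) => u v; lra.
have geo0 k : 0 <= geo k by rewrite exprn_ge0 // invr_ge0.
have lower_upper i j : a i - 2 * C * geo i <= a j + 2 * C * geo j.
  have mon : C * geo i >= 0 /\ C * geo j >= 0 by rewrite !mulr_ge0.
  have [leij|/ltnW leji] := leqP i j.
    have := step i (j - i)%N; rewrite subnKC // ler_norml => /andP[].
    move: mon; lra.
  have := step j (i - j)%N; rewrite subnKC // ler_norml => /andP[].
  move: mon; lra.
pose E := [set x | exists i, x = a i - 2 * C * geo i]%classic.
have E0 : (E !=set0)%classic by exists (a 0%N - 2 * C * geo 0%N), 0%N.
have ubE j : ubound E (a j + 2 * C * geo j) by move=> _ [i ->].
exists (sup E) => k; rewrite ler_norml.
have leS : a k - 2 * C * geo k <= sup E.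
  by apply: ub_le_sup; [exists (a 0%N + 2 * C * geo 0%N); apply: ubE | exists k].
have geS : sup E <= a k + 2 * C * geo k by apply: ge_sup E0 (ubE k).
by apply/andP; split; lra.
Qed.

Lemma Re_sub (z w : R[i]) : complex.Re (z - w) = complex.Re z - complex.Re w.
Proof. by case: z; case: w => a b c d; simpc. Qed.

Lemma Im_sub (z w : R[i]) : complex.Im (z - w) = complex.Im z - complex.Im w.
Proof. by case: z; case: w => a b c d; simpc. Qed.

Import Normc.

Lemma normc_ge0 (z : R[i]) : 0 <= normc z.
Proof. by case: z => a b; apply: sqrtr_ge0. Qed.

Lemma Re_le_normc (z : R[i]) : `|complex.Re z| <= normc z.
Proof. by case: z => a b /=; rewrite -sqrtr_sqr ler_wsqrtr // lerDl sqr_ge0. Qed.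

Lemma Im_le_normc (z : R[i]) : `|complex.Im z| <= normc z.
Proof. by case: z => a b /=; rewrite -sqrtr_sqr ler_wsqrtr // lerDr sqr_ge0. Qed.

Lemma normc_le_ReIm (z : R[i]) : normc z <= `|complex.Re z| + `|complex.Im z|.
Proof.
case: z => a b /=; rewrite -(ler_pXn2r (n := 2)) ?nnegrE ?addr_ge0 ?sqrtr_ge0 //.
rewrite sqr_sqrtr ?addr_ge0 ?sqr_ge0 // sqrrD !real_normK ?num_real //.
by rewrite lerD2r lerDl mulrn_wge0 // mulr_ge0.
Qed.

Lemma complex_geo_cvg (a : nat -> R[i]) C :
    (forall k, normc (a k.+1 - a k) <= C * geo k) ->
  exists s, forall k, normc (a k - s) <= 4 * C * geo k.
Proof.
move=> aC.
have [x xP] : exists s, forall k, `|complex.Re (a k) - s| <= 2 * C * geo k.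
  by apply: real_geo_cvg => k; rewrite -Re_sub (le_trans (Re_le_normc _)).
have [y yP] : exists s, forall k, `|complex.Im (a k) - s| <= 2 * C * geo k.
  by apply: real_geo_cvg => k; rewrite -Im_sub (le_trans (Im_le_normc _)).
exists (Complex x y) => k; apply: le_trans (normc_le_ReIm _) _.
by rewrite Re_sub Im_sub /=; have := xP k; have := yP k; lra.
Qed.

(** * Coordinate norm and the contraction principle *)

Section VectorNorm.
Variable V : vectType R[i].
Implicit Types (u v w : V) (c : R[i]).

(** An l1 norm with values in [R], whose order is total, unlike that of [R[i]]. *)
Definition vnorm v : R := \sum_i normc (v2r v 0 i).

Lemma vnorm_ge0 v : 0 <= vnorm v.
Proof. by apply: sumr_ge0 => i _; apply: normc_ge0. Qed.

Lemma vnorm0 : vnorm 0 = 0.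
Proof. by rewrite /vnorm big1 // => i _; rewrite linear0 mxE normc0. Qed.

Lemma vnormD u v : vnorm (u + v) <= vnorm u + vnorm v.
Proof.
rewrite -big_split; apply: ler_sum => i _; rewrite linearD mxE; exact: le_normcD.
Qed.

Lemma vnormZ c v : vnorm (c *: v) = normc c * vnorm v.
Proof. by rewrite mulr_sumr; apply: eq_bigr => i _; rewrite linearZ mxE normcM. Qed.

Lemma vnormN v : vnorm (- v) = vnorm v.
Proof. by apply: eq_bigr => i _; rewrite linearN mxE normcN. Qed.

Lemma vnorm_distC u v : vnorm (u - v) = vnorm (v - u).
Proof. by rewrite -vnormN opprB. Qed.

Lemma vnorm_eq0 v : vnorm v <= 0 -> v = 0.
Proof.
move=> v0; have : vnorm v == 0 by rewrite eq_le v0 vnorm_ge0.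
rewrite psumr_eq0 => [/allP z|i _]; last exact: normc_ge0.
apply: v2r_inj; apply/rowP=> i; rewrite linear0 mxE.
by apply: eq0_normc; apply/eqP/z; rewrite mem_index_enum.
Qed.

Lemma vnorm_sum (I : Type) (r : seq I) (f : I -> V) :
  vnorm (\sum_(i <- r) f i) <= \sum_(i <- r) vnorm (f i).
Proof.
elim/big_rec2: _ => [|i y x _ le]; first by rewrite vnorm0.
by apply: le_trans (vnormD _ _) _; rewrite lerD2l.
Qed.

Lemma v2r_sum v : v = \sum_i v2r v 0 i *: r2v (delta_mx 0 i).
Proof.
rewrite -[LHS]v2rK [v2r v in LHS]row_sum_delta linear_sum.
by apply: eq_bigr => i _; rewrite linearZ.
Qed.

Lemma vector_geo_cvg (a : nat -> V) C :
    (forall k, vnorm (a k.+1 - a k) <= C * geo k) ->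
  exists s M, forall k, vnorm (a k - s) <= M * geo k.
Proof.
move=> aC.
have /choice[s sP] i : exists s, forall k, normc (v2r (a k) 0 i - s) <= 4 * C * geo k.
  apply: complex_geo_cvg => k; apply: le_trans (aC k).
  have -> : v2r (a k.+1) 0 i - v2r (a k) 0 i = v2r (a k.+1 - a k) 0 i.
    by rewrite linearB !mxE.
  rewrite /vnorm (bigD1 i) //= lerDl sumr_ge0 // => j _; exact: normc_ge0.
exists (r2v (\row_i s i)), (\sum_(i < dim V) 4 * C) => k.
rewrite mulr_suml; apply: ler_sum => i _.
by rewrite linearB /= r2vK !mxE.
Qed.

(** Banach's argument: the iterates of [T] from [0] stay in the closed ball and converge
    geometrically to the fixed point [s]. *)
Lemma contraction_fixpoint (T : V -> V) r : 0 <= r ->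
    (forall v, vnorm v <= r -> vnorm (T v) <= r) ->
    (forall v w, vnorm v <= r -> vnorm w <= r ->
       vnorm (T v - T w) <= 2^-1 * vnorm (v - w)) ->
  exists2 v, vnorm v <= r & T v = v.
Proof.
move=> r0 Tr Tc; pose a k := iter k T 0.
have ar k : vnorm (a k) <= r by elim: k => [|k IHk]; [rewrite vnorm0 | exact: Tr].
have [s [M sM]] : exists s M, forall k, vnorm (a k - s) <= M * geo k.
  apply: (vector_geo_cvg (C := vnorm (a 1%N - a 0%N))).
  elim=> [|k IHk]; first by rewrite mulr1.
  apply: (le_trans (Tc (a k.+1) (a k) (ar _) (ar _))).
  by rewrite exprS mulrCA ler_pM2l // invr_gt0.
have sr : vnorm s <= r.
  rewrite -subr_le0; apply: (geo_small (M := M)) => k; rewrite lerBlDl.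
  by rewrite -[s](subKr (a k)) (le_trans (vnormD _ _)) // vnormN lerD.
exists s => //; apply/eqP; rewrite -subr_eq0; apply/eqP/vnorm_eq0.
apply: (geo_small (M := M)) => k.
have -> : T s - s = (T s - T (a k)) + (a k.+1 - s) by rewrite addrA subrK.
apply: le_trans (vnormD _ _) _.
have e := Tc s (a k) sr (ar k); rewrite [in leRHS]vnorm_distC in e.
have sk := sM k; have sk1 := sM k.+1; rewrite exprS in sk1.
by clear -e sk sk1; lra.
Qed.

End VectorNorm.
End Completeness.

(** * Strict differentiability *)

Section StrictDifferentiability.
Variable R : realType.
Implicit Types U V W X : vectType R[i].

Lemma linear_bounded V W (f : {linear V -> W}) :
  exists2 C, 0 <= C & forall v, vnorm (f v) <= C * vnorm v.
Proof.
exists (\sum_i vnorm (f (r2v (delta_mx 0 i)))).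
  by apply: sumr_ge0 => i _; apply: vnorm_ge0.
move=> v; rewrite [v in f v]v2r_sum linear_sum mulrC mulr_suml.
apply: le_trans (vnorm_sum _ _) _; apply: ler_sum => i _.
rewrite linearZ vnormZ /= ler_wpM2l ?normc_ge0 //.
rewrite (bigD1 i) //= lerDl sumr_ge0 // => j _; exact: vnorm_ge0.
Qed.

Lemma bilinear_bounded U V W (b : {bilinear U -> V -> W}) :
  exists2 C, 0 < C & forall u v, vnorm (b u v) <= C * vnorm u * vnorm v.
Proof.
have /choice[C CP] i : exists C, 0 <= C /\
    forall v, vnorm (b (r2v (delta_mx 0 i)) v) <= C * vnorm v.
  have [C C0 CP] := linear_bounded (b (r2v (delta_mx 0 i)) : {linear V -> W}).
  by exists C.
have sC : 0 <= \sum_i C i by apply: sumr_ge0 => i _; case: (CP i).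
exists (1 + \sum_i C i) => [|u v]; first by rewrite ltr_pwDl.
rewrite [u in b u v]v2r_sum linear_sumlz.
apply: (@le_trans _ _ ((\sum_i C i) * vnorm u * vnorm v)); last first.
  by rewrite !ler_wpM2r ?vnorm_ge0 // lerDr.
rewrite -mulrA mulrC -mulrA mulr_suml.
apply: le_trans (vnorm_sum _ _) _; apply: ler_sum => i _.
rewrite linearZl_LR vnormZ /= ler_wpM2l ?normc_ge0 //.
have [Ci /(_ v) Cv] := CP i; apply: le_trans Cv _.
rewrite mulrC ler_wpM2l ?vnorm_ge0 // (bigD1 i) //= lerDl sumr_ge0 // => j _.
by case: (CP j).
Qed.

(* [D] is the strict derivative of [f] at 0; only the Lipschitz property of [D]
   is recorded, so that derivatives can be plain functions. *)
Definition strict_derivative V W (f D : V -> W) : Prop :=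
  (exists2 C, 0 <= C & forall u w, vnorm (D u - D w) <= C * vnorm (u - w)) /\
  forall e, 0 < e -> exists2 d, 0 < d &
    forall u w, vnorm u < d -> vnorm w < d ->
      vnorm (f u - f w - (D u - D w)) <= e * vnorm (u - w).

Lemma eq_strict_derivative V W (f f' D D' : V -> W) :
  f =1 f' -> D =1 D' -> strict_derivative f D -> strict_derivative f' D'.
Proof. by move=> /funext-> /funext->. Qed.

Lemma strict_derivative_linear V W (f : {linear V -> W}) : strict_derivative f f.
Proof.
split=> [|e e0].
  have [C C0 CP] := linear_bounded f.
  by exists C => // u w; rewrite -linearB.
by exists 1 => // u w _ _; rewrite subrr vnorm0 mulr_ge0 ?vnorm_ge0 // ltW.
Qed.

Lemma strict_derivative_translate V W (f D : V -> W) c :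
  strict_derivative f D -> strict_derivative (fun v => c + f v) D.
Proof.
case=> DL fD; split=> // e /fD[d d0 dP]; exists d => // u w ud wd.
by rewrite opprD addrACA subrr add0r dP.
Qed.

Lemma strict_derivative_add V W (f D f' D' : V -> W) :
  strict_derivative f D -> strict_derivative f' D' ->
  strict_derivative (fun v => f v + f' v) (fun v => D v + D' v).
Proof.
case=> [[C C0 CP] fD] [[C' C'0 C'P] f'D']; split.
  exists (C + C') => [|u w]; first by rewrite addr_ge0.
  by rewrite opprD addrACA mulrDl (le_trans (vnormD _ _)) // lerD.
move=> e e0; have e2 : 0 < e / 2 by rewrite divr_gt0.
have [d d0 dP] := fD _ e2; have [d' d'0 d'P] := f'D' _ e2.
exists (Num.min d d') => [|u w]; first by rewrite lt_min d0.
rewrite !lt_min => /andP[ud ud'] /andP[wd wd'].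
have -> : f u + f' u - (f w + f' w) - (D u + D' u - (D w + D' w)) =
    (f u - f w - (D u - D w)) + (f' u - f' w - (D' u - D' w)).
  have dist (p q r t : W) : p + q - (r + t) = (p - r) + (q - t) by rewrite opprD addrACA.
  by rewrite (dist (f u)) (dist (D u)) dist.
apply: le_trans (vnormD _ _) _.
by rewrite [e]splitr mulrDl lerD ?dP ?d'P.
Qed.

Lemma strict_derivative_scale V W (f D : V -> W) c :
  strict_derivative f D -> strict_derivative (fun v => c *: f v) (fun v => c *: D v).
Proof.
case=> [[C C0 CP] fD]; have c0 := normc_ge0 c; split.
  exists (Normc.normc c * C) => [|u w]; first by rewrite mulr_ge0.
  by rewrite -scalerBr vnormZ -mulrA ler_wpM2l.
move=> e e0; have c1 : 0 < 1 + Normc.normc c by rewrite ltr_pwDl.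
have [d d0 dP] := fD _ (divr_gt0 e0 c1).
exists d => // u w ud wd; rewrite -!scalerBr vnormZ.
apply: le_trans (_ : (1 + Normc.normc c) * (e / (1 + Normc.normc c) * vnorm (u - w)) <= _).
  by rewrite ler_pM ?vnorm_ge0 ?dP // lerDr.
by rewrite mulrA mulrCA divff ?mulr1 // gt_eqF.
Qed.

Lemma strict_derivative_sum V W (f D : nat -> V -> W) n :
  (forall k, strict_derivative (f k) (D k)) ->
  strict_derivative (fun v => \sum_(k < n) f k v) (fun v => \sum_(k < n) D k v).
Proof.
move=> fD; elim: n => [|n IHn].
  apply: (eq_strict_derivative (f := \0) (D := \0)) => [v|v|]; rewrite ?big_ord0 //.
  exact: strict_derivative_linear.
by apply: eq_strict_derivative (strict_derivative_add IHn (fD n)) => v;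
  rewrite big_ord_recr.
Qed.

Lemma strict_derivative_lipschitz V W (f D : V -> W) : strict_derivative f D ->
  exists C d, [/\ 0 < C, 0 < d &
    forall u w, vnorm u < d -> vnorm w < d -> vnorm (f u - f w) <= C * vnorm (u - w)].
Proof.
case=> [[C C0 CP] /(_ 1 ltr01)[d d0 dP]]; exists (1 + C), d; split=> //.
  by rewrite ltr_pwDl.
move=> u w ud wd; rewrite -(subrK (D u - D w) (f u - f w)) mulrDl.
by rewrite (le_trans (vnormD _ _)) // lerD ?dP.
Qed.

(** Product rule. The error splits into four products, each with a small factor: the differentiation
    error of [f] or [f'], or a difference [f w - f 0] or [f' u - f' 0]. *)
Lemma strict_derivative_bilinear U V W X (b : {bilinear U -> V -> W})
    (f D : X -> U) (f' D' : X -> V) :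
  strict_derivative f D -> strict_derivative f' D' ->
  strict_derivative (fun v => b (f v) (f' v))
                    (fun v => b (f 0) (D' v) + b (D v) (f' 0)).
Proof.
move=> fD f'D'; have [B B0 BP] := bilinear_bounded b.
have [K [r [K0 r0 KP]]] := strict_derivative_lipschitz fD.
have [K' [r' [K'0 r'0 K'P]]] := strict_derivative_lipschitz f'D'.
case: fD f'D' => [[C C0 CP] fD] [[C' C'0 C'P] f'D'].
have bB u v p q : vnorm u <= p -> vnorm v <= q -> vnorm (b u v) <= B * (p * q).
  move=> up vq; apply: le_trans (BP _ _) _.
  by rewrite -mulrA ler_wpM2l ?(ltW B0) // ler_pM ?vnorm_ge0.
split.
  exists (B * vnorm (f 0) * C' + B * C * vnorm (f' 0)).
    by rewrite addr_ge0 ?mulr_ge0 ?vnorm_ge0 // ltW.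
  move=> u w; rewrite opprD addrACA -linearBr -linearBl mulrDl.
  apply: le_trans (vnormD _ _) _; apply: lerD.
    by rewrite -!mulrA; apply: bB.
  by rewrite -!mulrA [vnorm (f' 0) * _]mulrC [C * _]mulrA; apply: bB.
(* One bound for the Lipschitz constants and for the values of [f] and [f'] at small vectors of norm
   below [1]. *)
pose M := 1 + K + K' + C + C' + vnorm (f 0) + vnorm (f' 0).
have N0 := vnorm_ge0 (f 0); have N0' := vnorm_ge0 (f' 0).
have M1 : 1 <= M by rewrite /M; lra.
have CM : C <= M by rewrite /M; lra.
have C'M : C' <= M by rewrite /M; lra.
have KM : K + vnorm (f 0) <= M by rewrite /M; lra.
have K'M : K' + vnorm (f' 0) <= M by rewrite /M; lra.
clearbody M.
(* [e1] and, below, [d3] make each of the four products at most [e / 4] times [vnorm (u - w)]. *)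
move=> e e0; pose e1 := e / (B * 4 * M).
have BM : 0 < B * 4 * M by rewrite !mulr_gt0 //; lra.
have e10 : 0 < e1 by rewrite divr_gt0.
have [d1 d10 d1P] := fD _ e10; have [d2 d20 d2P] := f'D' _ e10.
pose d3 := e / (B * 4 * M * M).
have d30 : 0 < d3 by rewrite divr_gt0 // mulr_gt0 //; lra.
exists (Num.min (Num.min (Num.min d1 d2) (Num.min r r')) (Num.min d3 1)).
  by rewrite !lt_min d10 d20 r0 r'0 d30 ltr01.
move=> u w; rewrite !lt_min => /andP[/andP[/andP[ud1 ud2] /andP[ur ur']] /andP[ud3 u1]].
move=> /andP[/andP[/andP[wd1 wd2] /andP[wr wr']] /andP[wd3 w1]].
set n := vnorm (u - w); have n0 : 0 <= n by apply: vnorm_ge0.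
have M0 : 0 <= M by lra.
have near0 (Y : vectType R[i]) (g : X -> Y) K1 r1 v : 0 < r1 -> 0 < K1 <= M ->
    (forall u w, vnorm u < r1 -> vnorm w < r1 -> vnorm (g u - g w) <= K1 * vnorm (u - w)) ->
    vnorm v < r1 -> vnorm v < d3 -> vnorm (g v - g 0) <= M * d3.
  move=> r10 /andP[K10 K1M] gP vr vd; apply: le_trans (gP _ _ vr _) _; first by rewrite vnorm0.
  by rewrite subr0 ler_pM ?vnorm_ge0 // ltW.
have bnd (Y : vectType R[i]) (g : X -> Y) K1 r1 v : 0 < r1 -> 0 < K1 -> K1 + vnorm (g 0) <= M ->
    (forall u w, vnorm u < r1 -> vnorm w < r1 -> vnorm (g u - g w) <= K1 * vnorm (u - w)) ->
    vnorm v < r1 -> vnorm v < 1 -> vnorm (g v) <= M.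
  move=> r10 K10 K1M gP vr v1; rewrite -(subrK (g 0) (g v)).
  apply: le_trans (vnormD _ _) _; apply: le_trans _ K1M; rewrite lerD2r.
  apply: le_trans (gP _ _ vr _) _; first by rewrite vnorm0.
  by rewrite subr0 ler_piMr // ltW.
have f'u : vnorm (f' u) <= M by apply: (bnd _ _ K' r').
have fw : vnorm (f w) <= M by apply: (bnd _ _ K r).
have f'u0 : vnorm (f' u - f' 0) <= M * d3.
  by apply: (near0 _ _ K' r') => //; rewrite K'0 (le_trans _ K'M) // lerDl.
have fw0 : vnorm (f w - f 0) <= M * d3.
  by apply: (near0 _ _ K r) => //; rewrite K0 (le_trans _ KM) // lerDl.
have Dn : vnorm (D u - D w) <= M * n.
  by apply: le_trans (CP _ _) _; rewrite ler_wpM2r.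
have D'n : vnorm (D' u - D' w) <= M * n.
  by apply: le_trans (C'P _ _) _; rewrite ler_wpM2r.
have T1 := bB _ _ _ _ (d1P _ _ ud1 wd1) f'u.
have T2 := bB _ _ _ _ Dn f'u0.
have T3 := bB _ _ _ _ fw (d2P _ _ ud2 wd2).
have T4 := bB _ _ _ _ fw0 D'n.
have -> : b (f u) (f' u) - b (f w) (f' w) -
    (b (f 0) (D' u) + b (D u) (f' 0) - (b (f 0) (D' w) + b (D w) (f' 0))) =
  (b (f u - f w - (D u - D w)) (f' u) + b (D u - D w) (f' u - f' 0)) +
  (b (f w) (f' u - f' w - (D' u - D' w)) + b (f w - f 0) (D' u - D' w)).
  have -> : b (f u) (f' u) - b (f w) (f' w) =
      b (f u - f w) (f' u) + b (f w) (f' u - f' w).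
    by rewrite [b (f u - f w) _]linearBl [b _ (f' u - f' w)]linearBr addrA subrK.
  have -> : b (f u - f w - (D u - D w)) (f' u) + b (D u - D w) (f' u - f' 0) =
      b (f u - f w) (f' u) - b (D u - D w) (f' 0).
    by rewrite [b (_ - (D u - D w)) _]linearBl [b _ (f' u - f' 0)]linearBr addrA subrK.
  have -> : b (f w) (f' u - f' w - (D' u - D' w)) + b (f w - f 0) (D' u - D' w) =
      b (f w) (f' u - f' w) - b (f 0) (D' u - D' w).
    by rewrite [b _ (_ - (D' u - D' w))]linearBr [b (f w - f 0) _]linearBl addrA subrK.
  rewrite [RHS]addrACA -opprD; congr (_ - _).
  by rewrite [b (D u - D w) _]linearBl [b _ (D' u - D' w)]linearBr opprD addrACA addrC.
apply: le_trans (vnormD _ _) _.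
apply: le_trans (lerD (vnormD _ _) (vnormD _ _)) _.
apply: le_trans (lerD (lerD T1 T2) (lerD T3 T4)) _; rewrite -/n.
have Me1 : B * M * e1 = e / 4.
  by rewrite /e1; field; rewrite !gt_eqF // (lt_le_trans ltr01).
have Md3 : B * M * M * d3 = e / 4.
  by rewrite /d3; field; rewrite !gt_eqF // (lt_le_trans ltr01).
rewrite le_eqVlt; apply/orP; left; apply/eqP.
transitivity ((B * M * e1 + B * M * M * d3 + B * M * e1 + B * M * M * d3) * n); first by ring.
by rewrite Me1 Md3; field.
Qed.

End StrictDifferentiability.

(** * Orbits of null components *)

(** The map [T v = v - (f v - y)] halves distances near [0], and its fixed points solve
    [f v = y]. *)
Lemma local_inverse (R : realType) (V : vectType R[i]) (f : V -> V) :
  strict_derivative f id ->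
  exists2 d, 0 < d & forall y, vnorm (y - f 0) < d -> exists v, f v = y.
Proof.
case=> _ /(_ 2^-1) [|d d0 dP]; first by rewrite invr_gt0.
(* On the ball of radius [d / 2], the norm of [T v] is at most [vnorm (T 0) + d / 4], and
   [T 0 = y - f 0] has norm below [d / 4]. *)
exists (d / 4) => [|y yd]; first by rewrite divr_gt0.
pose T v := v - (f v - y).
have TP v w : vnorm v < d -> vnorm w < d -> vnorm (T v - T w) <= 2^-1 * vnorm (v - w).
  move=> vd wd; apply: le_trans (dP _ _ vd wd); rewrite vnorm_distC.
  suff -> : T w - T v = f v - f w - (v - w) by [].
  rewrite /T [- (v - _)]opprB [LHS]addrC [w - _]addrC addrACA [_ + w]addrC -(opprB v w); congr (_ - _).
  by rewrite opprB addrA subrK.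
have [|||v vd Tv] := @contraction_fixpoint R V T (d / 2).
- by rewrite divr_ge0 // ltW.
- move=> v vd; rewrite -(subrK (T 0) (T v)); apply: le_trans (vnormD _ _) _.
  have := TP v 0; rewrite subr0 vnorm0 => /(_ _ d0).
  have -> : T 0 = y - f 0 by rewrite /T sub0r opprB.
  have : vnorm v < d by lra.
  by move=> h /(_ h); lra.
- by move=> v w vd wd; apply: TP; lra.
exists v; apply/eqP; rewrite -subr_eq0 -oppr_eq0.
by rewrite -(addKr v (- _)) -[v - _]/(T v) Tv addNr.
Qed.

(** A linear choice of summands; the sum need not be direct. *)
Lemma addv_splitting (F : fieldType) (V : vectType F) (U W : {vspace V}) :
  exists p q : 'End(V), [/\ forall v, p v \in U, forall v, q v \in W &
    forall v, v \in (U + W)%VS -> v = p v + q v].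
Proof.
exists (addv_pi1 U W), (addv_pi2 U W); split=> v; [exact: memv_pi1 | exact: memv_pi2 |].
by move/addv_pi1_pi2.
Qed.

Section Orbits.
Variables (R : realType) (L : vectType R[i]) (mu : {bilinear L -> L -> L}).
Hypothesis leib : leibniz_identity mu.
Implicit Types (a x y z v w : L).

Local Notation ad := (rmul mu).
Local Notation G := (invariant_automorphism mu).

(** A function of [x], unlike the relation [exp_nilp], so that it can be differentiated; it is the
    exponential once the [n]-th power of [ad x] vanishes. *)
Definition trunc_exp n x v := \sum_(k < n) (k`!%:R)^-1 *: iter k (ad x) v.

(** As [x 0 = 0], terms with two or more factors [x v] have derivative zero. Only [k = 0] and
    [k = 1] contribute, and [n.+2] makes both present. *)
Lemma strict_derivative_exp n (f D x : L -> L) :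
    strict_derivative f D -> strict_derivative x x -> x 0 = 0 ->
  strict_derivative (fun v => trunc_exp n.+2 (x v) (f v))
    (fun v => D v + mu (f 0) (x v)).
Proof.
move=> fD xD x0.
pose D' k v := if k is j.+1 then (if j is _.+1 then 0 else mu (f 0) (x v)) else D v.
have iterD k : strict_derivative (fun v => iter k (ad (x v)) (f v)) (D' k).
  elim: k => [|k IHk]; first exact: fD.
  apply: eq_strict_derivative (strict_derivative_bilinear mu IHk xD) => v.
    by rewrite iterS rmulE.
  rewrite x0 linear0r addr0; case: k {IHk} => //= k.
  by rewrite rmulE linear0r linear0l.
have := strict_derivative_sum n.+2 (fun k => strict_derivative_scale ((k`!%:R)^-1) (iterD k)).
apply: eq_strict_derivative => // v.
rewrite !big_ord_recl big1 => [|i _]; last by rewrite scaler0.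
by rewrite /= invr1 !scale1r addr0.
Qed.

Lemma trunc_exp_invariant n x : lfun_exp (ad x) n = 0 ->
  exists2 d, G d & forall v, trunc_exp n x v = d v.
Proof.
move=> xn; have xg : exp_nilp (ad x) (\sum_(k < n) (k`!%:R)^-1 *: lfun_exp (ad x) k) by exists n.
by exists (\sum_(k < n) (k`!%:R)^-1 *: lfun_exp (ad x) k) => [|v];
  [exact: invariant_exp xg | rewrite exp_sumE].
Qed.

(** * Products of exponentials depending on a parameter *)

Section ExpPath.
Variables (I : Type) (x : I -> L -> L) (n : nat).
Hypothesis xD : forall i, strict_derivative (x i) (x i).
Hypothesis x0 : forall i, x i 0 = 0.
Hypothesis xn : forall i v, lfun_exp (ad (x i v)) n.+2 = 0.

Definition exp_path (s : seq I) (h : L -> L) v :=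
  foldr (fun i => trunc_exp n.+2 (x i v)) (h v) s.

Lemma exp_path0 s h : exp_path s h 0 = h 0.
Proof.
elim: s => //= i s; rewrite -/(exp_path s h 0) => ->.
rewrite x0 /trunc_exp big_ord_recl /= invr1 scale1r big1 ?addr0 // => k _.
by rewrite /= rmulE linear0r scaler0.
Qed.

Lemma strict_derivative_exp_path s h D : strict_derivative h D ->
  strict_derivative (exp_path s h) (fun v => D v + \sum_(i <- s) mu (h 0) (x i v)).
Proof.
move=> hD; elim: s => [|i s IHs].
  by apply: eq_strict_derivative hD => // v; rewrite big_nil addr0.
apply: eq_strict_derivative (strict_derivative_exp n IHs (xD i) (x0 i)) => // v.
by rewrite big_cons exp_path0 addrAC addrA.
Qed.

Lemma exp_path_invariant s h v : exists2 d, G d & exp_path s h v = d (h v).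
Proof.
elim: s => [|i s [d Gd dE]].
  by exists \1%VF; [exact: invariant_id | rewrite id_lfunE].
have [d' Gd' d'E] := trunc_exp_invariant (xn i v).
exists (d' \o d)%VF; first exact: invariant_automorphism_comp.
by rewrite comp_lfunE -dE -d'E.
Qed.

End ExpPath.

(* In a Leibniz algebra [a] itself may lie outside: take [a,a] = [b,a] = b, with
   all other products zero. *)
Lemma null_component_rep a : exists2 a0, a0 \in null_component (ad a) & ad a0 = ad a.
Proof.
have [s sE] := annihilating_roots (ad a).
pose g v := foldl (fun w m => ad a w - m *: w) v s.
have adf v : ad v = ad a -> ad (ad a v) = 0.
  move=> va; apply/lfunP=> w; rewrite zero_lfunE !rmulE leib.
  by rewrite -![mu _ v]rmulE va !rmulE subrr.
have shiftZ r c v : foldl (fun w m => ad a w - m *: w) (c *: v) r =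
    c *: foldl (fun w m => ad a w - m *: w) v r.
  elim: r v => //= m r IHr v.
  by rewrite -IHr scalerBr linearZ /= !scalerA [c * m]mulrC.
have shiftf r v : foldl (fun w m => ad a w - m *: w) (ad a v) r =
    ad a (foldl (fun w m => ad a w - m *: w) v r).
  by elim: r v => //= m r IHr v; rewrite -IHr [ad a (_ - _)]linearB /= [ad a (m *: v)]linearZ.
(* The product of all factors [ad a - m] sends [a] to [0]. A factor with [m] nonzero, rescaled,
   keeps the right multiplication by [adf]; one with [m = 0] does not affect membership in the null
   component and is dropped. *)
suff rep r v : ad v = ad a ->
    foldl (fun w m => ad a w - m *: w) v r \in null_component (ad a) ->
    exists2 a0, a0 \in null_component (ad a) & ad a0 = ad a.
  by apply: (rep s a) => //; rewrite sE mem0v.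
elim: r v => [|m r IHr] v va vr; first by exists v.
have [m0|m0] := eqVneq m 0.
  apply: IHr va _; move: vr; rewrite /= m0 scale0r subr0 shiftf.
  by rewrite (null_component_iter _ 1).
apply: (IHr (- m^-1 *: (ad a v - m *: v))).
  by rewrite rmulZ rmulB adf // sub0r rmulZ scaleNr scalerN opprK scalerA mulVf // scale1r.
by rewrite shiftZ memvZ.
Qed.

(** The map of the parameters [(h, c, z)] is composed with a linear section of its derivative at
    [0], so that [f] maps [L] to itself with derivative the identity. *)
Lemma open_orbit_rep a : a \in null_component (ad a) -> exists2 e, 0 < e & forall y, vnorm (y - a) < e ->
  exists d h, [/\ G d, h \in null_component (ad a) &
    null_component (ad y) = (d @: null_component (ad h))%VS].
Proof.
move=> aN; have [es [es_nil es_span]] := root_vectors leib a.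
set N := null_component (ad a); set Z := right_center mu.
pose X := in_tuple [seq mu a e | e <- es].
have ies (i : 'I_(size [seq mu a e | e <- es])) : (i < size es)%N.
  exact: leq_trans (ltn_ord i) (eq_leq (size_map _ _)).
have full v : v \in (N + (<<X>> + Z))%VS by rewrite tangent_span ?memvf.
have [h [u [hN uXZ huE]]] := addv_splitting N (<<X>> + Z).
have [w' [z' [w'X z'Z wzE]]] := addv_splitting <<X>> Z.
pose z := (z' \o u)%VF; pose w := (w' \o u)%VF.
have decomp v : v = h v + (w v + z v) by rewrite !comp_lfunE -wzE // -huE.
(* Multiples of the root vectors chosen so that the [mu a (x i v)] add up to [w v]. *)
pose x i v := coord X i (w v) *: es`_i.
have x_linear i : linear (x i).
  by move=> c v v'; rewrite /x [w _]linearP [coord X i _]linearP scalerDl scalerA.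
have wE v : w v = \sum_i mu a (x i v).
  have wX : w v \in <<X>>%VS by rewrite comp_lfunE.
  rewrite [LHS](coord_span wX); apply: eq_bigr => i _.
  rewrite linearZr_LR; congr (_ *: _); rewrite (nth_map 0) //.
have xD i : strict_derivative (x i) (x i).
  exact: (strict_derivative_linear (HB.pack (x i) (GRing.isLinear.Build _ _ _ _ (x i) (x_linear i)))).
(* One exponent serves all [i] and [v]: a nilpotent map vanishes at the power [dim L]. *)
have xn i v : lfun_exp (ad (x i v)) (dim L).+2 = 0.
  have [|k ek] := es_nil es`_i.
    by rewrite mem_nth.
  apply/lfunP=> v'; rewrite zero_lfunE lfun_expE; apply: (@iter_lfun_eq0 _ _ _ (dim L)).
    by rewrite -addn2 leq_addr.
  apply/eqP; rewrite -null_componentE; apply/null_componentP; exists k.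
  by rewrite /x rmulZ iter_scale_lfun -lfun_expE ek zero_lfunE scaler0.
have x0 i : x i 0 = 0 by rewrite /x [w 0]linear0 [coord X i 0]linear0 scale0r.
pose f v := exp_path x (dim L) (index_enum _) (fun v => a + h v) v + z v.
have h0 : h 0 = 0 by exact: linear0.
have fD : strict_derivative f id.
  have hD : strict_derivative (fun v => a + h v) h.
    exact/strict_derivative_translate/strict_derivative_linear.
  have zD : strict_derivative z z by apply: strict_derivative_linear.
  have := strict_derivative_add (strict_derivative_exp_path (dim L) xD x0 (index_enum _) hD) zD.
  apply: eq_strict_derivative => // v.
  by rewrite h0 addr0 -wE -addrA -decomp.
have f0 : f 0 = a by rewrite /f exp_path0 // h0 [z 0]linear0 !addr0.
have [e e0 eP] := local_inverse fD; rewrite f0 in eP.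
exists e => // y /eP[v <-].
have [d Gd dE] := exp_path_invariant xn (index_enum _) (fun v => a + h v) v.
exists d, (a + h v); split=> //.
  by rewrite memvD.
have -> : f v = d (a + h v) + z v by rewrite -dE.
have zZ : z v \in Z by rewrite comp_lfunE; apply: z'Z.
by rewrite (rmul_add_right_center _ zZ) (invariant_null_component leib _ Gd).
Qed.

(** Translation by [a - a0], whose right multiplication is zero, changes no null component and
    carries the statement from [a0] to [a]. *)
Lemma open_orbit a : exists2 e, 0 < e & forall y, vnorm (y - a) < e ->
  exists d h, [/\ G d, h \in null_component (ad a) &
    null_component (ad y) = (d @: null_component (ad h))%VS].
Proof.
have [a0 a0N a0E] := null_component_rep a; rewrite -a0E in a0N *.
have [e e0 eP] := open_orbit_rep a0N; exists e => // y ye.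
have adB : ad (y - (a - a0)) = ad y.
  by rewrite !rmulB a0E subrr subr0.
by have := eP (y - (a - a0)); rewrite adB opprB addrA addrAC addrK; apply.
Qed.

End Orbits.

(** * Conjugacy of null components of regular elements *)

(** Connectedness of the interval: the supremum of the points related to [0] is itself related to
    [0], and it cannot be below [1]. *)
Lemma unit_interval_chain (R : realType) (E : R -> R -> Prop) :
    (forall s t, E s t -> E t s) -> (forall r s t, E r s -> E s t -> E r t) ->
    (forall s, 0 <= s <= 1 -> exists2 e, 0 < e &
       forall t, 0 <= t <= 1 -> `|t - s| < e -> E s t) ->
  E 0 1.
Proof.
move=> Esym Etrans Eloc.
pose A := [set s | 0 <= s <= 1 /\ E 0 s]%classic.
have I0 : 0 <= (0 : R) <= 1 by apply/andP; split; lra.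
(* [E 0 0] is the local hypothesis at [s = t = 0]. *)
have A0 : A 0.
  by have [e e0 eP] := Eloc 0 I0; split=> //; apply: eP; rewrite ?subrr ?normr0.
have ubA : ubound A 1 by move=> s [/andP[]].
have supA : has_sup A by split; [exists 0 | exists 1].
have I : 0 <= sup A <= 1.
  apply/andP; split; first by apply: ub_le_sup => //; exists 1.
  by apply: ge_sup => //; exists 0.
have [e e0 eP] := Eloc _ I.
have [s [sI Es] se] := sup_adherent e0 supA.
have les : s <= sup A by apply: ub_le_sup => //; exists 1.
have E0 : E 0 (sup A).
  by apply: Etrans Es _; apply/Esym/eP => //; rewrite ler0_norm; lra.
have [le1|lt1] := leP 1 (sup A).
  by have <- : sup A = 1 by lra.
pose t := Num.min (sup A + e / 2) 1.
have tgt : sup A < t by rewrite lt_min; apply/andP; split; lra.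
have tI : 0 <= t <= 1 by rewrite ge_min lexx orbT andbT; lra.
have tle : t <= sup A + e / 2 by rewrite ge_min lexx.
have : t <= sup A.
  apply: ub_le_sup; first by exists 1.
  split=> //; apply: Etrans E0 _; apply: eP => //.
  by rewrite ger0_norm; lra.
by rewrite leNgt tgt.
Qed.

Lemma complex_path0 (R : realType) (c : R) : Complex 0 (c * (0 * (1 - 0))) = 0.
Proof. by rewrite mul0r mulr0. Qed.

Lemma complex_path1 (R : realType) (c : R) : Complex 1 (c * (1 * (1 - 1))) = 1.
Proof. by rewrite subrr !mulr0. Qed.

Section Conjugacy.
Variables (R : realType) (L : vectType R[i]) (mu : {bilinear L -> L -> L}).
Hypothesis leib : leibniz_identity mu.
Implicit Types (a b x y : L).

Local Notation ad := (rmul mu).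
Local Notation null x := (null_component (ad x)).

Definition regular a := forall x, (\dim (null a) <= \dim (null x))%N.

Lemma null_semicontinuous a b (t0 : R[i]) : exists2 p : {poly R[i]}, p.[t0] != 0 &
  forall t, p.[t] != 0 ->
    (\dim (null (a + t *: b)) <= \dim (null (a + t0 *: b)))%N.
Proof.
have [p p0 pP] := lker_semicontinuous t0
  (polynomial_family_exp (dim L) (polynomial_family_affine (ad a) (ad b))).
have adE t : ad (a + t *: b) = ad a + t *: ad b by rewrite rmulD rmulZ.
exists p; first exact: p0.
move=> t /pP; rewrite -!adE; exact.
Qed.

(** For [y] near [a], [null y] is conjugate to [null h] with [h] in [null a]. Regularity of [a] puts
    [null a] inside [null h], and regularity of [y] makes the dimensions equal. *)
Lemma regular_conjugate_near a : regular a -> exists2 e, 0 < e &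
  forall y, vnorm (y - a) < e -> regular y -> conjugate mu (null a) (null y).
Proof.
move=> areg; have [e e0 eP] := open_orbit leib a; exists e => // y /eP[d [h [Gd ha dh]]] yreg.
exists d; first exact: Gd.
suff -> : null a = null h by rewrite dh.
apply/eqP; rewrite eqEdim.
have [a0 a0N a0E] := null_component_rep leib a.
have sub x : x \in null a -> (null a <= null x)%VS.
  rewrite -a0E in a0N *; apply: (null_component_generic leib a0N (subvv _)) => y' _.
  by rewrite a0E; apply: areg.
rewrite (sub h ha) /=.
have hy : \dim (null h) = \dim (null y).
  by rewrite dh; apply: (@conjugate_dim _ _ mu); exists d.
exact: leq_trans (eq_leq hy) (yreg a).
Qed.

Lemma exists_small_nonroot (p : {poly R[i]}) (e : R) : p != 0 -> 0 < e ->
  exists2 t, Normc.normc t < e & p.[t] != 0.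
Proof.
move=> p0 e0; pose f (i : nat) : R[i] := (e / i.+2%:R)%:C%C.
have finj : injective f.
  move=> i j [] /(mulfI (lt0r_neq0 e0)) /invr_inj /eqP.
  by rewrite eqr_nat => /eqP [].
have fe i : Normc.normc (f i) < e.
  rewrite /f /= expr0n addr0 sqrtr_sqr ger0_norm ?divr_ge0 // ?ltW //.
  by rewrite ltr_pdivrMr ?ltr0n // ltr_pMr // ltr1n.
by have [i pi] := poly_nonroot_inj finj p0; exists (f i).
Qed.

(** Let [c] have the least nullity in [L]. Almost every point of the line through [a] and [c] has
    nullity at most that of [c]. One such point close to [a] has null component conjugate to some
    [null h] with [h] in [H], and [null h] contains [H] by nilpotency. *)
Lemma cartan_regular H : cartan_subalgebra mu H ->
  exists2 a, null a = H & regular a.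
Proof.
move=> Hc; have [a aH aN] := cartan_null_component leib Hc; exists a; first exact: aN.
have [c _ cmin] := @exists_argmin L (fun=> True) (fun x => \dim (null x)) 0 Logic.I.
have [e e0 eP] := open_orbit leib a.
have [p p1 pP] := null_semicontinuous a (c - a) 1.
have N1 : 0 < 1 + vnorm (c - a) by rewrite ltr_pwDl ?vnorm_ge0.
have [||t te pt] := @exists_small_nonroot p (e / (1 + vnorm (c - a))).
- by apply: contraNneq p1 => ->; rewrite horner0.
- by rewrite divr_gt0.
have [|d [h [Gd hN dh]]] := eP (a + t *: (c - a)).
  rewrite addrC addKr vnormZ; apply: le_lt_trans (_ : Normc.normc t * (1 + vnorm (c - a)) < _).
    by rewrite ler_wpM2l ?normc_ge0 // lerDr.
  by rewrite -ltr_pdivlMr.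
have {pP} := pP _ pt; rewrite scale1r [a + (c - a)]addrC subrK dh.
rewrite -(@conjugate_dim _ _ mu (null h) (d @: null h)%VS); last by exists d.
move=> hc x; apply: leq_trans (cmin x Logic.I); apply: leq_trans hc.
have [_ Hnil _] := Hc; rewrite aN; apply: dimvS.
by apply: nilpotent_subalgebra_null Hnil _ _; rewrite -aN.
Qed.

Lemma regular_path a b : regular a -> regular b -> exists c : R,
  forall s, 0 <= s <= 1 -> regular (a + (Complex s (c * (s * (1 - s)))) *: (b - a)).
Proof.
move=> areg breg; have [p p0 pP] := null_semicontinuous a (b - a) 0.
have pn0 : p != 0 by apply: contraNneq p0 => ->; rewrite horner0.
have [r pE] := closed_field_poly_normal p.
(* For [s] other than [0] and [1], the path meets the root [z] only at [s = Re z], and only when [c]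
   is this quotient. A zero denominator gives the quotient [0], which merely excludes [c = 0]. *)
pose l := [seq complex.Im z / (complex.Re z * (1 - complex.Re z)) | z <- r].
have [c cl] : exists c, (\prod_(z <- l) ('X - z%:P)).[c] != 0.
  exact/poly_nonroot/monic_neq0/monic_prod_XsubC.
exists c => s /andP[s0 s1] x.
have [->|sn0] := eqVneq s 0; first by rewrite complex_path0 scale0r addr0; apply: areg.
have [->|sn1] := eqVneq s 1.
  by rewrite complex_path1 scale1r [a + (b - a)]addrC subrK; apply: breg.
set t := Complex _ _; have pt : p.[t] != 0.
  apply: contra cl => /eqP pt0; rewrite -/(root _ _) root_prod_XsubC.
  apply/mapP; exists t; last first.
    by rewrite /= mulfK // mulf_neq0 // subr_eq0 eq_sym.
  move: pt0; rewrite pE hornerZ => /eqP; rewrite mulf_eq0 lead_coef_eq0 (negPf pn0) /=.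
  by rewrite -/(root _ _) root_prod_XsubC.
by apply: leq_trans (pP t pt) _; rewrite scale0r addr0.
Qed.

Lemma regular_conjugate a b : regular a -> regular b -> conjugate mu (null a) (null b).
Proof.
move=> areg breg; have [c cP] := regular_path areg breg.
pose t s : R[i] := Complex s (c * (s * (1 - s))).
pose g s := a + t s *: (b - a).
have gE s s' : g s' - g s = (t s' - t s) *: (b - a).
  by rewrite /g opprD addrACA subrr add0r scalerBl.
(* On the unit interval [1 - s' - s] lies between [-1] and [1], whence this Lipschitz constant. *)
have tlip s s' : 0 <= s <= 1 -> 0 <= s' <= 1 ->
    Normc.normc (t s' - t s) <= (1 + `|c|) * `|s' - s|.
  move=> sI s'I; apply: le_trans (normc_le_ReIm _) _.
  rewrite Re_sub Im_sub /= mulrDl mul1r lerD2l -mulrBr normrM ler_wpM2l //.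
  have -> : s' * (1 - s') - s * (1 - s) = (s' - s) * (1 - s' - s) by ring.
  by rewrite normrM ler_piMr // ler_norml; lra.
suff: conjugate mu (null (g 0)) (null (g 1)).
  rewrite /g /t complex_path0 complex_path1 scale0r addr0.
  by rewrite scale1r [a + (b - a)]addrC subrK.
apply: (@unit_interval_chain R (fun s s' => conjugate mu (null (g s)) (null (g s')))).
- by move=> s s'; apply: conjugate_sym.
- by move=> r s s'; apply: conjugate_trans.
move=> s sI; have [e e0 eP] := regular_conjugate_near (cP s sI).
have M0 : 0 < (1 + `|c|) * (1 + vnorm (b - a)) by rewrite mulr_gt0 // ltr_pwDl ?vnorm_ge0.
exists (e / ((1 + `|c|) * (1 + vnorm (b - a)))) => [|s' s'I]; first by rewrite divr_gt0.
rewrite ltr_pdivlMr // => s's; apply: eP (cP s' s'I).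
rewrite -/(t s) -/(t s') -/(g s) -/(g s') gE vnormZ; apply: le_lt_trans s's.
rewrite mulrA [`|_ - _| * _]mulrC ler_pM ?normc_ge0 ?vnorm_ge0 ?tlip //.
by rewrite lerDr.
Qed.

End Conjugacy.

Theorem theorem3p3 (R : realType) (L : vectType R[i])
    (mu : {bilinear L -> L -> L}) (H1 H2 : {vspace L}) :
  leibniz_identity mu ->
  cartan_subalgebra mu H1 -> cartan_subalgebra mu H2 ->
  exists2 delta : 'End(L),
    invariant_automorphism mu delta & (delta @: H1)%VS = H2.
Proof.
move=> leib /(cartan_regular leib)[a <- areg] /(cartan_regular leib)[b <- breg].
exact: regular_conjugate.
Qed.
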